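(* Let $\alpha<\omega_1$ be either a nonzero finite ordinal or a countable limit ordinal, let $s\colon\alpha\to\{\uparrow,\downarrow\}$ be any map, and let $M_{\alpha,s}$ be the associated surface and $\mathbb{P}_{\alpha,s}$ the associated (pre)ordered set. Then there is a natural bijection $$[M_{\alpha,s},\mathsf{R}]\;\simeq\;\{W\subset\mathbb{P}_{\alpha,s}\,:\,W\text{ is adapted}\},$$ namely the one sending the homotopy class of a continuous map $f\colon M_{\alpha,s}\to\mathsf{R}$ to the set $\mathfrak{C}(f)=\{\gamma<\alpha\,:\,f|_{\Delta_\gamma}\text{ is unbounded}\}$.
   Context: $[X,Y]$ denotes the set of (free) homotopy classes of continuous maps $X\to Y$. $\mathsf{R}=\omega_1\times[0,1[$ is the closed long ray, with the lexicographic order and the order topology; $\alpha\in\omega_1$ is identified with $(\alpha,0)\in\mathsf{R}$. A map into $\mathsf{R}$ is bounded if its image has an upper bound in $\mathsf{R}$. The first octant is $\mathsf{C}=\{(x,y)\in\mathsf{R}^2: y\le x\}$ with the induced topology; $\Delta_h=\{(x,0):x\in\mathsf{R}\}$ and $\Delta_d=\{(x,x):x\in\mathsf{R}\}$. The radius of $(x,y)\in\mathsf{C}$ is $x$. The surface $M_{\alpha,s}$ ($\alpha$ nonzero finite or countable limit, $s\colon\alpha\to\{\uparrow,\downarrow\}$): take copies $C_\gamma$ of $\mathsf{C}$, $\gamma<\alpha$. If $s(\gamma)=\uparrow$, the bottom edge of $C_\gamma$ is its copy of $\Delta_h$ and the top edge its copy of $\Delta_d$; if $s(\gamma)=\downarrow$,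 the bottom edge is its copy of $\Delta_d$ and the top edge its copy of $\Delta_h$. Identify the top edge of $C_\gamma$ with the bottom edge of $C_{\gamma+1}$ (when $\gamma+1<\alpha$) by matching points of equal radius; if $\alpha=n$ is finite, also identify in the same way the top edge of $C_{n-1}$ with the bottom edge of $C_0$; identify all points $(0,0)$ to a single point (the apex). Denote by $\Delta_\gamma$ ($\gamma<\alpha$) the image of the bottom edge of $C_\gamma$ (a copy of $\mathsf{R}$), and, if $\alpha$ is a limit ordinal, put $\Delta_\alpha=\Delta_0$, $C_\alpha=C_0$. Radius is well defined on $M_{\alpha,s}$. Topology: if $\alpha$ is finite, the quotient topology. If $\alpha$ is a limit ordinal: the apex has the neighborhood basis $\{\text{radius}<\varepsilon\}$, $\varepsilon>0$; points other than the apex not on any $\Delta_\lambda$ with $0<\lambda\le\alpha$ limit have the neighborhoods coming from the gluing of the (at most two) octants containing them; a point of radius $x>0$ on $\Delta_\lambda$, $0<\lambda\le\alpha$ limit, has as neighborhood basis the sets $V\cup\{q\in\bigcup_{\mu\le i<\lambda}C_i\setminus\Delta_\mu : a<\mathrm{radius}(q)<b\}$, where $\mu<\lambda$, $a<x<b$, and $V$ is a relatively open subset of $C_\lambda$ disjoint from the top edge of $C_\lambda$ whose intersection with $\Delta_\lambda$ is the set of points of $\Delta_\lambda$ with radius in $]a,b[$. (So the octants $C_i$, $i<\lambda$, accumulate on $\Delta_\lambda$, and for $\alpha$ limit all the octants accumulate on $\Delta_0$.) The (pre)ordered set $\mathbb{P}_{\alpha,s}=\langle\alpha,\prec\rangle$: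 $\prec$ is the reflexive and transitive closure of the relation $\prec'$ given, for $\gamma,\gamma+1<\alpha$, by $\gamma\prec'\gamma+1$ if $s(\gamma)=\uparrow$ and $\gamma+1\prec'\gamma$ if $s(\gamma)=\downarrow$, and moreover, if $\alpha=n$ is finite, $n-1\prec'0$ if $s(n-1)=\uparrow$ and $0\prec'n-1$ if $s(n-1)=\downarrow$. ($\prec$ need not be antisymmetric.) $W\subset\mathbb{P}_{\alpha,s}$ is adapted if: (i) $\gamma\in W$ and $\gamma\prec\gamma'$ imply $\gamma'\in W$; (ii) for every limit ordinal $\beta$ with $0<\beta\le\alpha$, putting $\beta^*=\beta$ if $\beta<\alpha$ and $\beta^*=0$ if $\beta=\alpha$, there exists $\gamma(\beta)<\beta$ such that for all $\gamma'\in[\gamma(\beta),\beta[$ one has $\gamma'\in W\Leftrightarrow\beta^*\in W$. *)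

(* Defs.v *)
From HB Require Import structures.
From Stdlib Require Import Relations.Relation_Operators.
From mathcomp Require Import all_boot all_order all_algebra.
From mathcomp Require Import generic_quotient.
From mathcomp Require Import all_classical all_reals all_analysis.
From mathcomp Require Import lra.
From mathcomp Require wochoice.

Set Implicit Arguments.
Unset Strict Implicit.
Unset Printing Implicit Defensive.

Import Order.TTheory GRing.Theory Num.Theory.
Import numFieldNormedType.Exports.

Local Open Scope order_scope.
Local Open Scope classical_set_scope.
Local Open Scope quotient_scope.

(* omega_1 is realised inside a well-ordering of the power set of nat, as the
   set of the points with countably many predecessors; [omega1_wf],
   [omega1_countable_below] and [omega1_uncountable] characterise it up to
   isomorphism. An element alpha of [omega1] is a countable ordinal, and the
   ordinal alpha = {gamma | gamma < alpha} itself is the type [below alpha]. *)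
Section WellOrderedPowerSet.

Definition wo_le : rel (set nat) :=
  projT1 (wochoice.well_ordering_principle (set nat)).

Lemma wo_leP : wochoice.well_order wo_le.
Proof. exact: projT2 (wochoice.well_ordering_principle (set nat)). Qed.

Let wo_chainT : @wochoice.wo_chain (set nat) wo_le predT.
Proof. by move=> A _; exact: wo_leP. Qed.

Lemma wo_le_refl : reflexive wo_le.
Proof. by move=> x; apply: (wochoice.wo_chain_reflexive wo_chainT). Qed.

Lemma wo_le_anti : antisymmetric wo_le.
Proof. by move=> x y; apply: (wochoice.wo_chain_antisymmetric wo_chainT). Qed.

Lemma wo_le_total : total wo_le.
Proof. by move=> x y; apply: (wochoice.wo_chainW wo_chainT). Qed.

Lemma wo_le_min (A : set (set nat)) :
  A !=set0 -> exists2 m, A m & forall x, A x -> wo_le m x.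
Proof.
move=> [a Aa]; have [|m [[Am mA] _]] := wo_leP (A := mem A).
  by exists a; rewrite inE.
by exists m => [|x Ax]; [rewrite inE in Am | apply: mA; rewrite inE].
Qed.

Lemma wo_le_trans : transitive wo_le.
Proof.
move=> y x z xy yz.
have [|m mA mle] := @wo_le_min [set t | [\/ t = x, t = y | t = z]].
  by exists x; apply: Or31.
case: mA => E; subst m; first by apply: mle; apply: Or33.
  by rewrite (@wo_le_anti x y) // xy mle //; apply: Or31.
by rewrite -(@wo_le_anti y z) // yz mle //; apply: Or32.
Qed.

End WellOrderedPowerSet.

Record omega1 := Omega1 {
  omega1_val :> set nat;
  _ : `[< countable [set y | wo_le y omega1_val && (y != omega1_val)] >] }.

HB.instance Definition _ := [isSub for omega1_val].
HB.instance Definition _ := [Choice of omega1 by <:].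

Fact omega1_display : Order.disp_t. Proof. exact: Order.Disp tt tt. Qed.

Definition omega1_le : rel omega1 := fun x y => wo_le (val x) (val y).

Lemma omega1_le_refl : reflexive omega1_le.
Proof. by move=> x; exact: wo_le_refl. Qed.

Lemma omega1_le_anti : antisymmetric omega1_le.
Proof. by move=> x y xy; apply: val_inj; exact: wo_le_anti. Qed.

Lemma omega1_le_trans : transitive omega1_le.
Proof. by move=> y x z; exact: wo_le_trans. Qed.

HB.instance Definition _ := Order.Le_isPOrder.Build omega1_display omega1
  omega1_le_refl omega1_le_anti omega1_le_trans.

Lemma omega1_le_total : total omega1_le.
Proof. by move=> x y; exact: wo_le_total. Qed.

HB.instance Definition _ :=
  Order.POrder_isTotal.Build omega1_display omega1 omega1_le_total.

Lemma omega1_wf (A : set omega1) :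
  A !=set0 -> exists2 m, A m & forall x, A x -> m <= x.
Proof.
move=> [a Aa]; have [|_ [m Am <-] mle] := @wo_le_min (val @` A).
  by exists (val a); exists a.
by exists m => // x Ax; apply: mle; exists x.
Qed.

Lemma omega1_countable_below (x : omega1) : countable [set y | y < x].
Proof.
have /asboolP/countable_injP[f finj] := valP x.
apply/countable_injP; exists (f \o val) => y z /[!inE] yx zx E.
apply: val_inj; apply: finj => //; rewrite inE /=.
- by move: yx; rewrite /= lt_neqAle andbC.
- by move: zx; rewrite /= lt_neqAle andbC.
Qed.

Lemma powerset_nat_uncountable : ~ countable [set: set nat].
Proof.
case/countable_injP => f finj.
pose D : set nat := [set n | exists2 A, f A = n & ~ A n].
have : ~ D (f D).
  move=> DfD; have [A fA nA] := DfD.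
  by apply: nA; rewrite (finj A D) ?inE.
by move=> nD; apply: (nD); exists D.
Qed.

Lemma omega1_uncountable : ~ countable [set: omega1].
Proof.
move=> c1.
have cval : countable (range (val : omega1 -> set nat)).
  by apply: sub_countable c1; exact: card_image_le.
have [] := @wo_le_min (~` range (val : omega1 -> set nat)).
  apply/set0P/negP => /eqP /(congr1 (@setC _)); rewrite setCK setC0 => E.
  by apply: powerset_nat_uncountable; rewrite -E.
move=> m nm mmin.
have cm : `[< countable [set y | wo_le y m && (y != m)] >].
  apply/asboolP; apply: sub_countable cval; apply: subset_card_le.
  move=> y /= /andP[ym neq]; apply: contrapT => ny.
  by move/negP: neq; apply; apply/eqP/wo_le_anti; rewrite ym mmin.
by apply: nm; exists (Omega1 cm).
Qed.

Lemma omega1_0_subproof : exists x : omega1, forall y : omega1, x <= y.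
Proof.
have [|m _ mle] := @omega1_wf [set: omega1]; last by exists m => y; exact: mle.
apply/set0P/negP => /eqP E; apply: omega1_uncountable; rewrite E.
exact: countable0.
Qed.

Definition omega1_0 : omega1 := sval (cid omega1_0_subproof).

Lemma omega1_0P x : omega1_0 <= x. 
Proof. by rewrite /omega1_0; case: cid. Qed.

Definition is_succ (x y : omega1) : Prop :=
  x < y /\ forall z, x < z -> y <= z.

Definition finite_ord (x : omega1) : Prop := finite_set [set y | y < x].

(* 0 is not a limit ordinal. *)
Definition limit_ord (x : omega1) : Prop :=
  x != omega1_0 /\ forall y, ~ is_succ y x.

Definition below (alpha : omega1) : Type := {x : omega1 | x < alpha}.

Section LongRay.
Variable R : realType.

Record unit_ico := UnitIco { ico_val :> R ; _ : (0 <= ico_val < 1)%R }.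

HB.instance Definition _ := [isSub for ico_val].
HB.instance Definition _ := [Choice of unit_ico by <:].

Fact ico_display : Order.disp_t. Proof. exact: Order.Disp tt tt. Qed.

HB.instance Definition _ :=
  [SubChoice_isSubOrder of unit_ico by <: with ico_display].

Fact ico0_subproof : (0 <= (0 : R) < 1)%R.
Proof. by rewrite lexx ltr01. Qed.

Definition ico0 : unit_ico := @UnitIco 0%R ico0_subproof.

Definition long_ray : Type := order_topology (omega1 *l unit_ico).

HB.instance Definition _ := OrderTopological.on long_ray.

Definition ray0 : long_ray := (omega1_0, ico0).

Lemma ray0P (x : long_ray) : ray0 <= x.
Proof.
case: x => x t; rewrite [_ <= _]Order.ProdLexiOrder.leEprodlexi /=.
rewrite omega1_0P /=; apply/implyP => _.
by have /andP[] := valP t.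
Qed.

Lemma long_ray_ltE (x y : long_ray) :
  (x < y) = (x.1 < y.1) || (x.1 == y.1) && (val x.2 < val y.2)%R.
Proof.
rewrite [_ < _]Order.ProdLexiOrder.ltEprodlexi le_eqVlt.
case: (ltgtP x.1 y.1) => //= [_|_].
Qed.

Lemma long_ray_gt0 (x : long_ray) : ray0 < x -> exists a, ray0 < a < x.
Proof.
rewrite long_ray_ltE /=; case: x => x t /=; rewrite lt_neqAle omega1_0P andbT.
pose u : R := if x == omega1_0 then val t else 1%R.
have half (v : R) : (0 < v <= 1)%R -> (0 <= v / 2 < 1)%R.
  by move=> /andP[v0 v1]; apply/andP; split; lra.
have hu : (0 < u)%R -> (0 <= u / 2 < 1)%R.
  move=> u0; apply: half; rewrite u0 /u; case: eqVneq => //= _.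
  by have /andP[_ /ltW] := valP t.
have u0 : (omega1_0 != x) || (omega1_0 == x) && (0 < val t)%R -> (0 < u)%R.
  by rewrite /u eq_sym; case: eqVneq => //=.
move=> /[dup] /u0 {}u0 xt; exists (omega1_0, @UnitIco (u / 2)%R (hu u0)).
rewrite !long_ray_ltE /= ltxx eqxx /= divr_gt0 //=.
rewrite lt_neqAle omega1_0P andbT; move: xt u0; rewrite /u eq_sym.
by case: eqVneq => //= _ t0 _; lra.
Qed.

Lemma long_ray_unbounded (x : long_ray) : exists b, x < b.
Proof.
case: x => x t; have /andP[t0 t1] := valP t.
have h : (0 <= (val t + 1) / 2 < 1)%R by apply/andP; split; lra.
have mid (v : R) : (v < 1)%R -> (v < (v + 1) / 2)%R by move=> v1; lra.
by exists (x, UnitIco h); rewrite long_ray_ltE /= eqxx ltxx mid.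
Qed.

Definition octant_set : set (long_ray * long_ray) := [set p | p.2 <= p.1].

Definition octant : Type := set_type octant_set.

HB.instance Definition _ := Topological.on octant.

Definition oct_coords (c : octant) : long_ray * long_ray := sval c.

Lemma oct_coords_inj : injective oct_coords.
Proof. by move=> c d; exact: val_inj. Qed.

Lemma oct_coordsP c : (oct_coords c).2 <= (oct_coords c).1.
Proof. exact: set_mem (valP c). Qed.

Definition oct_radius (c : octant) : long_ray := (oct_coords c).1.

Definition horizontal : set octant := [set c | (oct_coords c).2 = ray0].
Definition diagonal : set octant :=
  [set c | (oct_coords c).2 = (oct_coords c).1].

Lemma horizontal_inj (c d : octant) : horizontal c -> horizontal d ->
  oct_radius c = oct_radius d -> c = d.
Proof.
rewrite /horizontal /oct_radius /= => hc hd r.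
by apply: oct_coords_inj; rewrite [LHS]surjective_pairing
  [RHS]surjective_pairing hc hd r.
Qed.

Lemma diagonal_inj (c d : octant) : diagonal c -> diagonal d ->
  oct_radius c = oct_radius d -> c = d.
Proof.
rewrite /diagonal /oct_radius /= => hc hd r.
by apply: oct_coords_inj; rewrite [LHS]surjective_pairing
  [RHS]surjective_pairing hc hd r.
Qed.

Lemma horizontal_diagonal (c : octant) :
  horizontal c -> diagonal c -> oct_radius c = ray0.
Proof. by rewrite /horizontal /diagonal /oct_radius /= => -> ->. Qed.

Inductive direction := Up | Down.

Definition bottom_edge (d : direction) : set octant :=
  if d is Up then horizontal else diagonal.

Definition top_edge (d : direction) : set octant :=
  if d is Up then diagonal else horizontal.

Lemma bottom_edge_inj s (c d : octant) : bottom_edge s c -> bottom_edge s d ->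
  oct_radius c = oct_radius d -> c = d.
Proof. by case: s; [exact: horizontal_inj | exact: diagonal_inj]. Qed.

Lemma top_edge_inj s (c d : octant) : top_edge s c -> top_edge s d ->
  oct_radius c = oct_radius d -> c = d.
Proof. by case: s; [exact: diagonal_inj | exact: horizontal_inj]. Qed.

Lemma bottom_top_edge s (c : octant) :
  bottom_edge s c -> top_edge s c -> oct_radius c = ray0.
Proof.
by case: s => /= b t; [exact: horizontal_diagonal | exact: horizontal_diagonal].
Qed.

Section Surface.
Variables (alpha : omega1) (s : below alpha -> direction).

Definition octants : Type := {_ : below alpha & octant}.

HB.instance Definition _ := Topological.on octants.

Definition octant_pt (g : below alpha) (c : octant) : octants := existT _ g c.

(* The top edge of the octant g is to be glued to the bottom edge of the
   octant h: either h = g + 1, or alpha is finite, g = alpha - 1 and h = 0. *)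
Definition next_octant (g h : below alpha) : Prop :=
  is_succ (val g) (val h) \/
  [/\ finite_ord alpha, is_succ (val g) alpha & val h = omega1_0].

Lemma is_succ_fun x y z : is_succ x y -> is_succ x z -> y = z.
Proof.
move=> [xy ymin] [xz zmin]; apply/eqP.
by rewrite eq_le ymin // zmin.
Qed.

Lemma is_succ_inj x y z : is_succ x z -> is_succ y z -> x = y.
Proof.
move=> [xz xmin] [yz ymin]; apply/eqP; rewrite eq_le.
apply/andP; split; rewrite leNgt; apply/negP.
  by move=> /ymin; rewrite leNgt xz.
by move=> /xmin; rewrite leNgt yz.
Qed.

Lemma next_fun g h k : next_octant g h -> next_octant g k -> h = k.
Proof.
move=> [gh|[_ ga h0]] [gk|[_ ga' k0]]; apply: val_inj.
- exact: is_succ_fun gh gk.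
- by have := valP h; rewrite (is_succ_fun gh ga') ltxx.
- by have := valP k; rewrite (is_succ_fun gk ga) ltxx.
- by rewrite h0.
Qed.

Lemma next_inj g h k : next_octant g k -> next_octant h k -> g = h.
Proof.
move=> [gk|[_ ga k0]] [hk|[_ ha k0']]; apply: val_inj.
- exact: is_succ_inj gk hk.
- by have := gk.1; rewrite k0' ltNge omega1_0P.
- by have := hk.1; rewrite k0 ltNge omega1_0P.
- exact: is_succ_inj ga ha.
Qed.

Definition edge_match (p q : octants) : Prop :=
  [/\ next_octant (tag p) (tag q),
      top_edge (s (tag p)) (tagged p),
      bottom_edge (s (tag q)) (tagged q) &
      oct_radius (tagged p) = oct_radius (tagged q)].

Definition is_origin (p : octants) : Prop :=
  oct_coords (tagged p) = (ray0, ray0).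

(* This is already transitive ([glued_trans]): a point other than the origin
   is matched with at most one other point. *)
Definition glued (p q : octants) : Prop :=
  [\/ p = q, is_origin p /\ is_origin q, edge_match p q | edge_match q p].

Lemma is_originE p : is_origin p <-> oct_radius (tagged p) = ray0.
Proof.
rewrite /is_origin /oct_radius; split=> [->//|r0].
have := oct_coordsP (tagged p); rewrite r0 => le0.
rewrite [LHS]surjective_pairing r0.
by congr pair; apply/eqP; rewrite eq_le le0 ray0P.
Qed.

Lemma glued_radius p q :
  glued p q -> oct_radius (tagged p) = oct_radius (tagged q).
Proof.
case=> [->//|[op oq]|[_ _ _ ->]//|[_ _ _ ->]//].
by rewrite (proj1 (is_originE p) op) (proj1 (is_originE q) oq).
Qed.

Lemma glued_refl p : glued p p. Proof. exact: Or41. Qed.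

Lemma glued_sym p q : glued p q -> glued q p.
Proof.
case=> [->|[op oq]|pq|qp]; [exact: Or41 | exact: Or42 | exact: Or44 |].
exact: Or43.
Qed.

Lemma glued_trans q p r : glued p q -> glued q r -> glued p r.
Proof.
move=> pq qr; have rpq := glued_radius pq; have rqr := glued_radius qr.
have allO : is_origin q -> glued p r.
  move=> /is_originE q0; apply: Or42; split; apply/is_originE.
    by rewrite rpq.
  by rewrite -rqr.
case: pq qr => [->//|[_ /allO//]|pq|qp]; case=> [<-|[/allO//]|qr|rq].
- exact: Or43.
- apply: allO; apply/is_originE.
  by case: pq qr => _ _ b _ [_ t _ _]; exact: bottom_top_edge b t.
- apply: Or41; move: p r pq rq {rpq rqr allO} =>
  [g c] [h d] [/= n1 t1 _ r1] [/= n2 t2 _ r2].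
  have gh := next_inj n1 n2; subst h.
  by rewrite (top_edge_inj t1 t2) // r1 r2.
- exact: Or44.
- apply: Or41; move: p r qp qr {rpq rqr allO} =>
  [g c] [h d] [/= n1 _ t1 r1] [/= n2 _ t2 r2].
  have gh := next_fun n1 n2; subst h.
  by rewrite (bottom_edge_inj t1 t2) // -r1 r2.
- apply: allO; apply/is_originE.
  by case: qp rq => _ t _ _ [_ _ b _]; exact: bottom_top_edge b t.
Qed.

Definition gluedb : rel octants := fun p q => `[< glued p q >].

Lemma gluedb_refl : reflexive gluedb.
Proof. by move=> p; apply/asboolP; exact: glued_refl. Qed.

Lemma gluedb_sym : symmetric gluedb.
Proof. by move=> p q; apply/asbool_equiv_eq; split; exact: glued_sym. Qed.

Lemma gluedb_trans : transitive gluedb.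
Proof.
move=> q p r /asboolP pq /asboolP qr; apply/asboolP.
exact: glued_trans pq qr.
Qed.

Canonical gluedb_equiv := EquivRel gluedb gluedb_refl gluedb_sym gluedb_trans.

Definition surface : Type := {eq_quot gluedb_equiv}.

HB.instance Definition _ := EqQuotient.on surface.
HB.instance Definition _ := Choice.on surface.

Definition surf_pt (g : below alpha) (c : octant) : surface :=
  \pi_surface (octant_pt g c).

Definition surf_radius (q : surface) : long_ray := oct_radius (tagged (repr q)).

Lemma pi_glued (p q : octants) :
  \pi_surface p = \pi_surface q <-> glued p q.
Proof.
split => [/eqP|pq]; first by rewrite piE => /asboolP.
by apply/eqP; rewrite piE; apply/asboolP.
Qed.

Lemma radius_pi (p : octants) :
  surf_radius (\pi_surface p) = oct_radius (tagged p).
Proof. by apply: glued_radius; apply/pi_glued; rewrite reprK. Qed.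

Definition is_apex (p : surface) : Prop :=
  exists2 q, is_origin q & p = \pi_surface q.

Definition octant_image (g : below alpha) : set surface := range (surf_pt g).

Definition Delta (g : below alpha) : set surface :=
  surf_pt g @` bottom_edge (s g).

(* [star b g]: the index b <= alpha, when it is alpha, is read as 0; thus
   Delta_alpha = Delta_0 and C_alpha = C_0 for a limit ordinal alpha. *)
Definition star (b : omega1) (g : below alpha) : Prop :=
  val g = b \/ b = alpha /\ val g = omega1_0.

Definition on_limit_edge (p : surface) : Prop :=
  exists lam g, [/\ limit_ord lam, lam <= alpha, star lam g & Delta g p].

(* The neighbourhood system used when alpha is infinite. In [glued_nbhd], B is a
   neighbourhood of p for the gluing of the octants containing p: its trace on
   each of these octants is a neighbourhood of the corresponding point. In
   [limit_nbhd], the octants i with mu <= i < lam accumulate on Delta lam. *)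
Inductive basic_nbhd (p : surface) : set surface -> Prop :=
| apex_nbhd (e : long_ray) : is_apex p -> ray0 < e ->
    basic_nbhd p [set q | surf_radius q < e]
| glued_nbhd B : ~ is_apex p -> ~ on_limit_edge p ->
    (forall q : octants, \pi_surface q = p ->
       nbhs q (\pi_surface @^-1` B)) -> basic_nbhd p B
| limit_nbhd lam g (mu : below alpha) (a b : long_ray) (V : set octant) :
    limit_ord lam -> lam <= alpha -> star lam g -> Delta g p ->
    val mu < lam -> a < surf_radius p -> surf_radius p < b ->
    open V -> V `&` top_edge (s g) = set0 ->
    V `&` bottom_edge (s g) =
      [set c | bottom_edge (s g) c /\ a < oct_radius c < b] ->
    basic_nbhd p (surf_pt g @` V `|`
      ((\bigcup_(i in [set i : below alpha | val mu <= val i < lam])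
          octant_image i `\` Delta mu) `&` [set q | a < surf_radius q < b])).

Definition surface_open (U : set surface) : Prop :=
  (finite_ord alpha -> open (U : set (quotient_topology surface))) /\
  (~ finite_ord alpha ->
     forall p, U p -> exists2 B, basic_nbhd p B & B `<=` U).

Lemma next_infinite g h :
  ~ finite_ord alpha -> next_octant g h -> is_succ (val g) (val h).
Proof. by move=> inf [//|[]]. Qed.

Lemma apex_radius p : is_apex p <-> surf_radius p = ray0.
Proof.
split=> [[q oq ->]|r0]; first by rewrite radius_pi; apply/is_originE.
by exists (repr p); [apply/is_originE | rewrite reprK].
Qed.

Lemma Delta_inj g h p : ~ is_apex p -> ~ finite_ord alpha ->
  Delta g p -> Delta h p -> g = h.
Proof.
move=> nap inf [c bc cp] [d bd dp].
have r0 : oct_radius c <> ray0.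
  move=> r; apply: nap; exists (octant_pt g c) => //.
  by apply/is_originE.
have : glued (octant_pt g c) (octant_pt h d).
  by apply/pi_glued; rewrite [LHS]cp [RHS]dp.
case=> [[]//|[/is_originE]//|[_ tc _ _]|[_ td _ r]].
- by case: r0; exact: bottom_top_edge bc tc.
- by case: r0; rewrite -r; exact: bottom_top_edge bd td.
Qed.

Lemma star_inj lam lam' g : limit_ord lam -> limit_ord lam' ->
  star lam g -> star lam' g -> lam = lam'.
Proof.
move=> [l0 _] [l0' _] [gl|[la g0]] [gl'|[la' g0']].
- by rewrite -gl.
- by rewrite -gl g0' eqxx in l0.
- by rewrite -gl' g0 eqxx in l0'.
- by rewrite la.
Qed.

Lemma basic_nbhd_exists p : ~ finite_ord alpha -> exists B, basic_nbhd p B.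
Proof.
move=> inf; have [ap|nap] := pselect (is_apex p).
  have [e e0] := long_ray_unbounded ray0.
  by exists [set q | surf_radius q < e]; exact: apex_nbhd.
have [[lam [g [lim lea st Dp]]]|nl] := pselect (on_limit_edge p); last first.
  exists setT; apply: glued_nbhd => // q _; rewrite preimage_setT.
  exact: filterT.
have r0 : ray0 < surf_radius p.
  by rewrite lt_neqAle ray0P andbT; apply/eqP => r; apply/nap/apex_radius.
have [a /andP[a0 ar]] := long_ray_gt0 r0.
have [b rb] := long_ray_unbounded (surf_radius p).
have lam0 : omega1_0 < lam by rewrite lt_neqAle omega1_0P eq_sym lim.1.
pose mu : below alpha := exist _ omega1_0 (lt_le_trans lam0 lea).
pose V : set octant := oct_coords @^-1` [set z |
  a < z.1 < b /\ if s g is Up then z.2 < a else ray0 < z.2].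
have oV : open V.
  exists [set z : long_ray * long_ray |
    a < z.1 < b /\ if s g is Up then z.2 < a else ray0 < z.2] => //.
  have o1 (u v : long_ray) : open [set z : long_ray * long_ray | u < z.1 < v].
    exact: (@open_comp _ long_ray (@fst long_ray long_ray) `]u, v[%classic
      (fun x _ => @cvg_fst _ _ _ _ _) (@itv_open _ _ u v)).
  have o2 (v : long_ray) : open [set z : long_ray * long_ray | z.2 < v].
    exact: (@open_comp _ long_ray (@snd long_ray long_ray) `]-oo, v[%classic
      (fun x _ => @cvg_snd _ _ _ _ _) (@lray_open _ _ v)).
  have o3 (v : long_ray) : open [set z : long_ray * long_ray | v < z.2].
    have oy : open [set y : long_ray | v < y].
      by rewrite -[X in open X]set_itvoy; exact: rray_open.
    exact: (@open_comp _ long_ray (@snd long_ray long_ray) _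
      (fun x _ => @cvg_snd _ _ _ _ _) oy).
  case: (s g); [exact: openI (o1 a b) (o2 a) | exact: openI (o1 a b) (o3 _)].
eexists; apply: (@limit_nbhd p lam g mu a b V) => //.
- apply/seteqP; split => // c [[/andP[a1 _]]]; rewrite /top_edge.
  case: (s g); rewrite /diagonal /horizontal /=.
    by move=> c2 E; move: c2; rewrite E ltNge (ltW a1).
  by move=> c2 E; move: c2; rewrite E ltxx.
- apply/seteqP; split => c /=; rewrite /V /oct_radius /=.
    by move=> [[? _] ?].
  move=> [bc ac]; split => //; split => //; move: bc; rewrite /bottom_edge.
  case: (s g); rewrite /diagonal /horizontal /= => ->; first exact: a0.
  by case/andP: ac => + _; exact: lt_trans.
Qed.

Lemma basic_nbhdI p B1 B2 : ~ finite_ord alpha ->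
  basic_nbhd p B1 -> basic_nbhd p B2 ->
  exists2 B, basic_nbhd p B & B `<=` B1 `&` B2.
Proof.
move=> inf.
have radN a : is_apex p -> a < surf_radius p -> False.
  by move=> /apex_radius ->; rewrite ltNge ray0P.
have onl lam g : limit_ord lam -> lam <= alpha -> star lam g -> Delta g p ->
  on_limit_edge p by move=> *; exists lam, g.
case=> [e1 ap e10|B1' nap nl nb1|lam g m1 a1 b1 V1 lim lea st Dp m1l a1r rb1
  oV1 tV1 bV1].
- case=> [e2 _ e20|? /(_ ap)//|? ? ? ? ? ? _ _ _ _ _ /(radN _ ap)//].
  exists [set q | surf_radius q < Order.min e1 e2].
    by apply: apex_nbhd; rewrite // lt_min e10.
  by move=> q /=; rewrite lt_min => /andP[].
- case=> [? /nap//|B2' _ _ nb2|? ? ? ? ? ? l1 l2 l3 l4]; last first.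
    by case: nl; exact: onl l1 l2 l3 l4.
  exists (B1' `&` B2') => //; apply: glued_nbhd => // q qp.
  by rewrite preimage_setI; apply: filterI; [exact: nb1 | exact: nb2].
case=> [? /radN /(_ a1r)//|? _ /(_ (onl _ _ lim lea st Dp))//|].
move=> lam' g' m2 a2 b2 V2 lim' lea' st' Dp' m2l a2r rb2 oV2 tV2 bV2.
have nap : ~ is_apex p by move=> /radN /(_ a1r).
have E := Delta_inj nap inf Dp Dp'; subst g'.
have E := star_inj lim lim' st st'; subst lam'.
pose m : below alpha := if val m1 <= val m2 then m2 else m1.
have m1m : val m1 <= val m by rewrite /m; case: ifP.
have m2m : val m2 <= val m.
  by rewrite /m; case: ifPn => //; rewrite -ltNge => /ltW.
have ml : val m < lam by rewrite /m; case: ifP.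
pose a := Order.max a1 a2; pose b := Order.min b1 b2.
exists (surf_pt g @` (V1 `&` V2) `|`
  ((\bigcup_(i in [set i : below alpha | val m <= val i < lam])
      octant_image i `\` Delta m) `&` [set q | a < surf_radius q < b])).
  apply: (limit_nbhd lim lea st Dp ml).
  - by rewrite gt_max a1r.
  - by rewrite lt_min rb1.
  - exact: openI.
  - by rewrite -setIA tV2 setI0.
  - rewrite setIIl bV1 bV2; apply/seteqP; split => c /=.
      move=> [[bc /andP[l1 u1]] [_ /andP[l2 u2]]].
      by rewrite gt_max lt_min l1 l2 u1 u2.
    rewrite gt_max lt_min => -[bc /andP[/andP[-> ->] /andP[-> ->]]] //.
have key m' q : val m' <= val m ->
    (\bigcup_(i in [set i : below alpha | val m <= val i < lam])
      octant_image i `\` Delta m) q -> ray0 < surf_radius q ->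
    (\bigcup_(i in [set i : below alpha | val m' <= val i < lam])
      octant_image i `\` Delta m') q.
  move=> m'm [[i /= /andP[mi il] [c _ cq]] nD] r0; split.
    by exists i; [rewrite /= (le_trans m'm mi) | exists c].
  move=> [d bd dq].
  have rc : oct_radius c <> ray0.
    by move: r0; rewrite -cq radius_pi /= => /[swap] ->; rewrite ltxx.
  have : glued (octant_pt i c) (octant_pt m' d).
    by apply/pi_glued; rewrite [LHS]cq [RHS]dq.
  case=> [[E1 E2]|[/is_originE]//|[/= n _ _ _]|[/= n td _ r]].
  - apply: nD; have mE : m = m'.
      by apply: val_inj; apply/eqP; rewrite eq_le m'm andbT -E1.
    by rewrite mE; exists d.
  - have := (next_infinite inf n).1; rewrite ltNge.
    by rewrite (le_trans m'm mi).
  - by case: rc; rewrite -r; exact: bottom_top_edge bd td.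
move=> q [[c [V1c V2c] cq]|[qS /= /andP[+ +]]].
  by split; left; exists c.
rewrite gt_max lt_min => /andP[l1 l2] /andP[u1 u2].
have r0 : ray0 < surf_radius q by exact: le_lt_trans (ray0P _) l1.
split; right; split => /=; rewrite ?l1 ?l2 //.
  exact: key m1m qS r0.
exact: key m2m qS r0.
Qed.

Lemma surface_openT : surface_open setT.
Proof.
split=> [_|inf p _]; first exact: openT.
by have [B pB] := basic_nbhd_exists p inf; exists B.
Qed.

Lemma surface_openI U V :
  surface_open U -> surface_open V -> surface_open (U `&` V).
Proof.
move=> [fU iU] [fV iV]; split=> [fin|inf p [Up Vp]].
  by apply: openI; [exact: fU | exact: fV].
have [B1 pB1 B1U] := iU inf p Up; have [B2 pB2 B2V] := iV inf p Vp.
have [B pB BI] := basic_nbhdI inf pB1 pB2.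
by exists B => // q /BI[/B1U ? /B2V].
Qed.

Lemma surface_open_bigcup (I : Type) (U : I -> set surface) :
  (forall i, surface_open (U i)) -> surface_open (\bigcup_i U i).
Proof.
move=> oU; split=> [fin|inf p [i _ Up]].
  by apply: bigcup_open => i _; exact: (oU i).1.
have [B pB BU] := (oU i).2 inf p Up.
by exists B => // q /BU; exists i.
Qed.

HB.instance Definition _ := @isOpenTopological.Build surface
  surface_open surface_openT surface_openI surface_open_bigcup.

Definition prec_step (g h : below alpha) : Prop :=
  next_octant g h /\ s g = Up \/ next_octant h g /\ s h = Down.

Definition prec : below alpha -> below alpha -> Prop :=
  clos_refl_trans (below alpha) prec_step.

Definition adapted (W : set (below alpha)) : Prop :=
  (forall g h, W g -> prec g h -> W h) /\
  (forall b, limit_ord b -> b <= alpha ->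
     exists2 gb : omega1, gb < b &
       forall g bstar : below alpha,
         gb <= val g < b -> star b bstar -> (W g <-> W bstar)).

Definition unbounded_indices (f : surface -> long_ray) : set (below alpha) :=
  [set g | ~ exists b, forall p, Delta g p -> f p <= b].

End Surface.
End LongRay.

Section Homotopy.
Local Open Scope ring_scope.
Variables (R : realType) (X Y : topologicalType).

Definition homotopic (f g : continuousType X Y) : Prop :=
  exists H : X * R -> Y,
    [/\ {within [set: X] `*` `[0, 1]%classic, continuous H},
        forall x, H (x, 0) = f x & forall x, H (x, 1) = g x].

Lemma homotopic_refl f : homotopic f f.
Proof.
exists (fun z => f z.1); split => //.
apply: continuous_subspaceT => z.
by apply: continuous_comp; [exact: cvg_fst | exact: cts_fun].
Qed.

Lemma within_reparam (H : X * R -> Y) (phi : R -> R) (A : set R) :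
  continuous phi -> (forall t, A t -> `[0, 1]%classic (phi t)) ->
  {within [set: X] `*` `[0, 1]%classic, continuous H} ->
  {within [set: X] `*` A, continuous (fun z => H (z.1, phi z.2))}.
Proof.
move=> cphi phiA cH.
move/subspace_continuousP: cH => cH; apply/subspace_continuousP.
move=> [x t] [_ /= At] W /(cH (x, phi t) (conj I (phiA t At))).
move=> [[U V] /= [nU nV] UV].
exists (U, phi @^-1` V) => /=; first by split=> //; exact: cphi.
move=> [y u] [/= Uy Vu] [_ /= Au]; apply: (UV (y, phi u)) => //.
by split => //; exact: phiA.
Qed.

Lemma homotopic_sym f g : homotopic f g -> homotopic g f.
Proof.
move=> [H [cH H0 H1]]; exists (fun z => H (z.1, 1 - z.2)); split => [|x|x].
- apply: (@within_reparam H (fun t => 1 - t)) cH => [t|t /=].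
    by apply: cvgB; [exact: cvg_cst | exact: cvg_id].
  by rewrite !in_itv /= => /andP[t0 t1]; apply/andP; split; lra.
- by rewrite /= subr0.
- by rewrite /= subrr.
Qed.

Lemma homotopic_trans g f h : homotopic f g -> homotopic g h -> homotopic f h.
Proof.
move=> [H [cH H0 H1]] [K [cK K0 K1]].
pose L (z : X * R) := if z.2 <= 2^-1 then H (z.1, z.2 *+ 2)
                      else K (z.1, z.2 *+ 2 - 1).
exists L; split => [|x|x].
- have -> : [set: X] `*` `[0, 1]%classic =
    ([set: X] `*` `[0, 2^-1]%classic) `|` ([set: X] `*` `[2^-1, 1 : R]%classic).
    apply/seteqP; split => [[x t] [_]|[x t] [[_]|[_]]]; rewrite /= in_itv /=.
    + move=> /andP[t0 t1]; have [th|th] := leP t 2^-1.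
        by left; split=> //; rewrite /= ?in_itv /= t0 th.
      by right; split=> //; rewrite /= ?in_itv /= t1 ltW.
    + by move=> /andP[t0 t1]; split; rewrite //= in_itv /=; apply/andP;
      split; lra.
    + by move=> /andP[t0 t1]; split; rewrite //= in_itv /=; apply/andP;
      split; lra.
  have closed_strip (u v : R) : closed ([set: X] `*` `[u, v]%classic).
    have -> : [set: X] `*` `[u, v]%classic = snd @^-1` `[u, v]%classic.
      by apply/seteqP; split => [[x t] []|[x t]].
    by apply: preimage_closed => [z _|]; [exact: cvg_snd | exact: itv_closed].
  apply: withinU_continuous; [exact: closed_strip | exact: closed_strip | |].
  + apply: (@subspace_eq_continuous _ _ _
      (fun z : X * R => H (z.1, z.2 *+ 2))).
      move=> [x t] /set_mem [_] /=; rewrite in_itv /= => /andP[_ th].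
      by rewrite /from_subspace /L /= th.
    apply: (@within_reparam H (fun t => t *+ 2)) cH => [t|t /=].
      by apply: cvgMn; exact: cvg_id.
    by rewrite !in_itv /= => /andP[t0 t1]; apply/andP; split; lra.
  + apply: (@subspace_eq_continuous _ _ _
      (fun z : X * R => K (z.1, z.2 *+ 2 - 1))).
      move=> [x t] /set_mem [_] /=; rewrite in_itv /= => /andP[th _].
      rewrite /from_subspace /L /=; case: ifP => // th'.
      have -> : t = 2^-1 by apply/eqP; rewrite eq_le th th'.
      have -> : (2^-1 : R) *+ 2 = 1 by lra.
      by rewrite subrr H1 K0.
    apply: (@within_reparam K (fun t => t *+ 2 - 1)) cK => [t|t /=].
      apply: cvgB; last exact: cvg_cst.
      by apply: cvgMn; exact: cvg_id.
    by rewrite !in_itv /= => /andP[t0 t1]; apply/andP; split; lra.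
- by rewrite /L /= invr_ge0 ler0n mul0rn H0.
- rewrite /L /= ifF; last by apply/negbTE; rewrite -ltNge; lra.
  by rewrite mulr2n addrK K1.
Qed.

Definition homotopicb : rel (continuousType X Y) :=
  fun f g => `[< homotopic f g >].

Lemma homotopicb_refl : reflexive homotopicb.
Proof. by move=> f; apply/asboolP; exact: homotopic_refl. Qed.

Lemma homotopicb_sym : symmetric homotopicb.
Proof. by move=> f g; apply/asbool_equiv_eq; split; exact: homotopic_sym. Qed.

Lemma homotopicb_trans : transitive homotopicb.
Proof.
move=> g f h /asboolP fg /asboolP gh; apply/asboolP.
exact: homotopic_trans gh.
Qed.

Canonical homotopicb_equiv :=
  EquivRel homotopicb homotopicb_refl homotopicb_sym homotopicb_trans.

Definition homotopy_classes : Type := {eq_quot homotopicb_equiv}.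

Definition homotopy_class (f : continuousType X Y) : homotopy_classes :=
  \pi_({eq_quot homotopicb_equiv}) f.

End Homotopy.

(* Main.v *)
Require Import Defs.
From mathcomp Require Import all_boot all_order all_algebra.
From mathcomp Require Import generic_quotient.
From mathcomp Require Import all_classical all_reals all_analysis.
From mathcomp Require Import lra.

(* Say that f controls g when g is bounded on each set where f is bounded,
   uniformly. If f and g control each other, the ordinals d such that f < d and
   g < d agree up to boundary values form an unbounded set, which cuts the long
   ray into intervals such that f(x) and g(x) always lie in the same one. Each
   of these intervals is an ordinary segment, so f can be pushed down to
   min(f, g) along paths in the long ray, whence f ~ min(f, g) ~ g.

   On an octant, a leapfrog argument on the diagonal shows that a continuous map
   is equivalent, for mutual control, to the radius, to the height y or to 0,
   according to which edges it is unbounded on. Since there are countably many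
   octants, the set of the edges on which f is unbounded determines f up to
   homotopy, and the maps radius, y, 0 on the octants glue to a realisation of
   any adapted set. Invariance of this set under homotopy and its compatibility
   with limit ordinals are one and the same pigeonhole argument: among omega_1
   strict inequalities, each stable on a neighbourhood taken from a countable
   family, uncountably many are stable on a common neighbourhood. *)

Set Implicit Arguments.
Unset Strict Implicit.
Unset Printing Implicit Defensive.

Import Order.TTheory GRing.Theory Num.Theory.
Import numFieldNormedType.Exports.

Local Open Scope order_scope.
Local Open Scope classical_set_scope.

(** * Countable ordinals *)

(** Regularity of omega_1: if the values [h i] had no common strict bound, omega_1 would be a
    countable union of countable initial segments. *)
Lemma countable_family_bound (T : Type) (A : set T) (h : T -> omega1) :
  countable A -> exists b, forall i, A i -> h i < b.
Proof.
move=> cA; apply: contrapT => nb; apply: omega1_uncountable.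
have -> : [set: omega1] = \bigcup_(i in A) ([set y | y < h i] `|` [set h i]).
  apply/seteqP; split => // y _; apply: contrapT => ny; apply: nb.
  exists y => i Ai; rewrite ltNge; apply/negP => yh; apply: ny.
  by exists i => //=; move: yh; rewrite le_eqVlt => /orP[/eqP|]; [right|left].
apply: bigcup_countable => // i _.
rewrite -bigcup2E; apply: bigcup_countable => // -[|[|k]] _ /=.
- exact: omega1_countable_below.
- exact: countable1.
- exact: countable0.
Qed.

Lemma omega1_gt (x : omega1) : exists y, x < y.
Proof.
have [b bP] := countable_family_bound (fun x => x) (countable1 x).
by exists b; exact: bP.
Qed.

Lemma succ_exists (x : omega1) : exists y, is_succ x y.
Proof.
have [y xy ymin] := @omega1_wf [set y | x < y] (omega1_gt x).
by exists y; split.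
Qed.

Lemma countable_le (x : omega1) : countable [set y | y <= x].
Proof.
have [b xb] := omega1_gt x.
apply: sub_countable (omega1_countable_below b); apply: subset_card_le.
by move=> y /= /le_lt_trans; exact.
Qed.

(** Closing off: [d] is the supremum of a sequence of iterates, each of which bounds [h] on
    everything up to the previous one, so any [x < d] is caught at a finite stage. *)
Lemma closed_ordinal (h : omega1 -> omega1) (x0 : omega1) :
  exists2 d, x0 < d & forall x, x < d -> h x < d.
Proof.
have step x : exists y, x < y /\ forall z, z <= x -> h z < y.
  have [b hb] := countable_family_bound h (countable_le x).
  have [c xc] := omega1_gt x.
  exists (Order.max b c); split=> [|z zx]; first by rewrite lt_max xc orbT.
  by rewrite lt_max hb.
have [g gP] := choice step.
have [b0 ub] := countable_family_bound (fun n => iter n g x0)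
  (countableP [set: nat]).
have [|d dub dmin] := @omega1_wf [set b | forall n, iter n g x0 < b].
  by exists b0 => n; exact: ub.
exists d; first exact: (dub 0%N).
move=> x xd; have [n xn] : exists n, x <= iter n g x0.
  apply: contrapT => nn; have : d <= x.
    by apply: dmin => n; rewrite ltNge; apply/negP => xn; apply: nn; exists n.
  by rewrite leNgt xd.
by apply: lt_trans (dub n.+1) => /=; have [_] := gP (iter n g x0); exact.
Qed.

(** If every value were avoided from some ordinal on, an ordinal [b] beyond these countably many
    thresholds would have no value left for [N b]. *)
Lemma pigeonhole (N : omega1 -> nat) :
  exists n, forall x, exists2 y, x <= y & N y = n.
Proof.
apply: contrapT => nN.
have bad n : exists x, forall y, x <= y -> N y <> n.
  apply: contrapT => nx; apply: nN; exists n => x.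
  apply: contrapT => ny; apply: nx; exists x => y xy Ny.
  by apply: ny; exists y.
have [x xP] := choice bad.
have [b bP] := countable_family_bound x (countableP [set: nat]).
by apply: (xP (N b) b) => //; exact/ltW/bP.
Qed.

Lemma limit_succ_lt b x y : limit_ord b -> is_succ x y -> x < b -> y < b.
Proof.
move=> [_ nb] xy xb; rewrite lt_neqAle (xy.2 _ xb) andbT.
by apply/eqP => E; rewrite E in xy; exact: nb xy.
Qed.

Lemma limit_gt0 b : limit_ord b -> omega1_0 < b.
Proof. by move=> lb; rewrite lt_neqAle omega1_0P andbT eq_sym lb.1. Qed.

(** Finitely many ordinals below a limit have a strict bound [c] still below it, by taking
    successors and maxima; if they were all the ordinals below [b], then [c < c]. *)
Lemma limit_infinite b : limit_ord b -> ~ finite_ord b.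
Proof.
move=> lb finb; have [r rE] := (finite_seqP _).1 finb.
have [c cb cr] : exists2 c : omega1, c < b & forall y : omega1, y \in r ->
  y < c.
  have : forall y : omega1, y \in r -> y < b.
    by move=> y yr; have : [set` r] y by []; rewrite -rE.
  elim: r {rE} => [_|y r IH yr].
    by exists omega1_0 => //; exact: limit_gt0.
  have [|c cb cr] := IH; first by move=> z zr; apply: yr; rewrite inE zr orbT.
  have [z yz] := succ_exists y.
  have zb : z < b by apply: limit_succ_lt yz _ => //; apply: yr;
    rewrite mem_head.
  exists (Order.max c z); first by rewrite gt_max cb.
  move=> w; rewrite inE lt_max => /orP[/eqP ->|/cr ->//]; by rewrite yz.1 orbT.
by have : [set y | y < b] c by []; rewrite rE => /cr; rewrite ltxx.
Qed.

(** * The order topology of the long ray *)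

Section OrderTopology.
Context {d} {T : orderTopologicalType d}.
Implicit Types a b x : T.

Lemma near_gt a x : a < x -> \forall y \near x, a < y.
Proof.
by move=> ax; have := open_nbhs_nbhs (conj (rray_open a) _ : open_nbhs x _);
  rewrite set_itvE; exact.
Qed.

Lemma near_lt b x : x < b -> \forall y \near x, y < b.
Proof.
by move=> ax; have := open_nbhs_nbhs (conj (lray_open b) _ : open_nbhs x _);
  rewrite set_itvE; exact.
Qed.

Lemma cvg_near_gt (X : Type) (F : set_system X) (f : X -> T) a x :
  f @ F --> x -> a < x -> \forall t \near F, a < f t.
Proof. by move=> fx /near_gt; exact: fx. Qed.

Lemma cvg_near_lt (X : Type) (F : set_system X) (f : X -> T) b x :
  f @ F --> x -> x < b -> \forall t \near F, f t < b.
Proof. by move=> fx /near_lt; exact: fx. Qed.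

Lemma cvg_order (X : Type) (F : set_system X) (f : X -> T) x : Filter F ->
  (forall a, a < x -> \forall t \near F, a < f t) ->
  (forall b, x < b -> \forall t \near F, f t < b) -> f @ F --> x.
Proof.
move=> FF fl fr U; rewrite itv_nbhsE => -[i [oi xi] iU].
apply: (@filterS _ F _ (fun t => f t \in i)) => [t /iU//|].
case: i oi xi {iU} => [[[] a|[]] [[] b|[]]] //= _; rewrite in_itv /= ?andbT.
- move=> /andP[ax xb]; near=> t; rewrite in_itv /=; apply/andP.
  by split; near: t; [exact: fl | exact: fr].
- by move=> ax; near=> t; rewrite in_itv /= andbT; near: t; exact: fl.
- by move=> xb; near=> t; rewrite in_itv /=; near: t; exact: fr.
- by move=> _; near=> t; rewrite in_itv.
Unshelve. all: by end_near. Qed.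

Lemma closed_le_fun (X : topologicalType) (f : X -> T) b :
  continuous f -> closed [set x | f x <= b].
Proof.
move=> cf; have -> : [set x | f x <= b] = f @^-1` `]-oo, b]%classic.
  by apply/seteqP; split => x; rewrite /= in_itv.
by apply: preimage_closed => // x _; exact: cf.
Qed.

Lemma closed_ge_fun (X : topologicalType) (f : X -> T) b :
  continuous f -> closed [set x | b <= f x].
Proof.
move=> cf; have -> : [set x | b <= f x] = f @^-1` `[b, +oo[%classic.
  by apply/seteqP; split => x; rewrite /= in_itv /= andbT.
by apply: preimage_closed => // x _; exact: cf.
Qed.

End OrderTopology.

Section Ray.
Variable R : realType.
Local Notation ray := (long_ray R).
Implicit Types x y z : ray.

Definition ord_pt (b : omega1) : ray := (b, ico0 R).

Lemma ltr_ord_pt (b : omega1) x : (x < ord_pt b) = (x.1 < b).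
Proof.
by rewrite long_ray_ltE /=; case/andP: (valP x.2) => + _; case: ltgtP => //= _;
  rewrite leNgt => /negbTE.
Qed.

Lemma ler_ord_pt (b : omega1) x : (ord_pt b <= x) = (b <= x.1).
Proof. by rewrite !leNgt ltr_ord_pt. Qed.

Lemma ord_pt_le (b c : omega1) : (ord_pt b <= ord_pt c) = (b <= c).
Proof. by rewrite ler_ord_pt. Qed.

Lemma ord_pt_lt (b c : omega1) : (ord_pt b < ord_pt c) = (b < c).
Proof. by rewrite ltr_ord_pt. Qed.

Lemma ray_fst_le x y : x <= y -> x.1 <= y.1.
Proof. by move=> xy; rewrite -ler_ord_pt (le_trans _ xy) // ler_ord_pt. Qed.

Lemma ray_bound x : exists b, x < ord_pt b.
Proof. by have [b xb] := omega1_gt x.1; exists b; rewrite ltr_ord_pt. Qed.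

Lemma ray0E : ray0 R = ord_pt omega1_0. Proof. by []. Qed.

Lemma ray_dense x y : x < y -> exists z, x < z < y.
Proof.
have mid (u v : R) : (0 <= u < 1)%R -> (u < v <= 1)%R ->
    {w : unit_ico R | (u < val w < v)%R}.
  move=> /andP[u0 u1] /andP[uv v1].
  have h : (0 <= (u + v) / 2 < 1)%R by apply/andP; split; lra.
  by exists (UnitIco h) => /=; apply/andP; split; lra.
rewrite long_ray_ltE; case: x y => [x s] [y t] /=.
case: ltgtP => //= [xy _|-> st].
  have [|w /andP[sw _]] := mid (val s) 1%R (valP s).
    by case/andP: (valP s) => _ ->; rewrite lexx.
  by exists (x, w); rewrite !long_ray_ltE /= ltxx eqxx sw xy.
have [|w /andP[sw wt]] := mid (val s) (val t) (valP s).
  by rewrite st; case/andP: (valP t) => _ /ltW.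
by exists (y, w); rewrite !long_ray_ltE /= ltxx eqxx sw wt.
Qed.

Lemma nbhs_right x (U : set ray) : nbhs x U ->
  exists2 y, x < y & forall z, x <= z -> z < y -> U z.
Proof.
rewrite itv_nbhsE => -[i [oi xi] iU].
case: i oi xi iU => [[[] a|[]] [[] b|[]]] //= _; rewrite in_itv /= ?andbT.
- move=> /andP[ax xb] iU; exists b => // z xz zb.
  by apply: iU; rewrite /= in_itv /= zb (lt_le_trans ax).
- move=> ax iU; have [b xb] := long_ray_unbounded x; exists b => // z xz zb.
  by apply: iU; rewrite /= in_itv /= (lt_le_trans ax).
- by move=> xb iU; exists b => // z xz zb; apply: iU; rewrite /= in_itv.
- move=> _ iU; have [b xb] := long_ray_unbounded x; exists b => // z xz zb.
  by apply: iU; rewrite /= in_itv.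
Qed.

(** [Q] collects the points with rational second coordinate over the countably many ordinals below
    [d]; rationals outside [0,1[ are sent to 0 by the default of [insubd]. *)
Lemma countable_dense (d : omega1) : exists2 Q : set ray, countable Q &
  forall x U, x.1 < d -> nbhs x U -> exists2 q, Q q & U q.
Proof.
pose m (p : omega1 * rat) : ray := (p.1, insubd (ico0 R) (ratr p.2 : R)).
exists (m @` ([set b | b < d] `*` [set: rat])).
  apply: (@sub_countable _ _ _ ([set b : omega1 | b < d] `*` [set: rat])).
    exact: card_image_le.
  by apply: countableX; [exact: omega1_countable_below | exact: countableP].
move=> x U xd /nbhs_right[y xy yU].
(* [v] is where the part of the fibre over [x.1] lying before [y] ends: at 1 when [y] lies over a
   larger ordinal. *)
pose v : R := if x.1 == y.1 then val y.2 else 1%R.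
have [x0 x1] := andP (valP x.2); have [y0 y1] := andP (valP y.2).
have xv : (val x.2 < v <= 1)%R.
  move: xy; rewrite long_ray_ltE /v; case: eqVneq => /= [->|_ _].
    by rewrite ltxx /= => ->; exact/ltW.
  by rewrite x1 lexx.
have [v0 v1] := andP xv.
have [r] := rat_in_itvoo v0; rewrite in_itv /= => /andP[xr rv].
have rI : (0 <= (ratr r : R) < 1)%R.
  by rewrite (le_trans x0 (ltW xr)) (lt_le_trans rv v1).
have mE : m (x.1, r) = (x.1, UnitIco rI).
  congr pair; apply: val_inj; rewrite /= val_insubd /=.
  by case: ifPn => //; rewrite [X in ~~ X]rI.
exists (m (x.1, r)); first by exists (x.1, r).
apply: yU; rewrite mE.
  by apply: ltW; rewrite long_ray_ltE /= ltxx eqxx.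
move: xy rv; rewrite !long_ray_ltE /= /v; case: (ltgtP x.1 y.1) => //=.
Qed.

End Ray.

(** * Paths in the long ray *)

Section OrdinalEmbedding.
Local Open Scope ring_scope.
Variables (R : realType) (d : omega1) (e : omega1 -> nat).
Hypothesis e_inj : {in [set y | (y < d)%O] &, injective e}.

(** [S] below is the classical embedding of a countable ordinal into the reals: [S b] is the sum of
    [2^-(e c + 1)] over the ordinals [c] below both [b] and [d], the term of index [k] being present
    when [k = e c] for such a [c]. *)
Let hit (b : omega1) (k : nat) : bool :=
  `[< exists2 c, (c < b)%O /\ (c < d)%O & e c = k >].
Let weight (b : omega1) (k : nat) : R := if hit b k then 2^-1 ^+ k.+1 else 0.
Let psum (b : omega1) (n : nat) : R := \sum_(k < n) weight b k.
Let S (b : omega1) : R := sup (range (psum b)).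

Let weight_ge0 b k : 0 <= weight b k.
Proof. by rewrite /weight; case: ifP => // _;
  rewrite exprn_ge0 // invr_ge0. Qed.

Let hit_mono b c k : (b <= c)%O -> hit b k -> hit c k.
Proof.
move=> bc /asboolP[x [xb xd] xk]; apply/asboolP; exists x => //.
by rewrite (lt_le_trans xb).
Qed.

Let weight_mono b c k : (b <= c)%O -> weight b k <= weight c k.
Proof.
move=> bc; rewrite {1}/weight; case: ifPn => [hb|_]; last exact: weight_ge0.
by rewrite /weight (hit_mono bc).
Qed.

Let psum_le1 b n : psum b n <= 1.
Proof.
suff: psum b n <= 1 - 2^-1 ^+ n.
  have : 0 <= (2^-1 : R) ^+ n by rewrite exprn_ge0 // invr_ge0.
  by move=> ? ?; lra.
rewrite /psum; elim: n => [|n IH]; first by rewrite big_ord0 expr0 subrr.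
rewrite big_ord_recr /=.
have : weight b n <= 2^-1 ^+ n.+1.
  by rewrite /weight; case: ifP => // _; rewrite exprn_ge0 // invr_ge0.
by rewrite exprS; lra.
Qed.

Let psum_sup b : has_sup (range (psum b)).
Proof.
split; first by exists (psum b 0%N); exists 0%N.
by exists 1 => _ [n _ <-]; exact: psum_le1.
Qed.

Let psum_le b n : psum b n <= S b.
Proof. by apply: ub_le_sup; [case: (psum_sup b) | exists n]. Qed.

Let S_le b r : (forall n, psum b n <= r) -> S b <= r.
Proof.
move=> br; apply: ge_sup; first by case: (psum_sup b).
by move=> _ [n _ <-].
Qed.

Let psum_nondecr b : {homo psum b : m n / (m <= n)%N >-> m <= n}.
Proof.
apply: homo_leq => [//|y x z|n]; first exact: le_trans.
by rewrite /psum big_ord_recr /= lerDl weight_ge0.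
Qed.

(** Passing from [b] to [c] gains at least the term of index [e b], which injectivity of [e] keeps
    out of [S b]. *)
Let S_lt b c : (b < c)%O -> (c <= d)%O -> S b < S c.
Proof.
move=> bc cd; have bd := lt_le_trans bc cd.
suff: S b + 2^-1 ^+ (e b).+1 <= S c.
  have : 0 < (2^-1 : R) ^+ (e b).+1 by rewrite exprn_gt0 // invr_gt0.
  by move=> ? ?; lra.
rewrite -lerBrDr; apply: S_le => n; rewrite lerBrDr.
apply: le_trans (psum_le c (maxn n (e b).+1)).
apply: le_trans (_ : psum b (maxn n (e b).+1) + 2^-1 ^+ (e b).+1 <= _).
  by rewrite lerD2r psum_nondecr // leq_maxl.
set m := maxn _ _; have bm : (e b < m)%N by rewrite leq_maxr.
rewrite /psum (bigD1 (Ordinal bm)) // [leRHS](bigD1 (Ordinal bm)) //=.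
have -> : weight b (e b) = 0.
  rewrite /weight ifF //; apply/negP => /asboolP[x [xb xd] exb].
  by move: xb; rewrite (e_inj _ _ exb) ?inE ?ltxx.
have -> : weight c (e b) = 2^-1 ^+ (e b).+1.
  by rewrite /weight ifT //; apply/asboolP; exists b.
rewrite add0r [leLHS]addrC lerD2l; apply: ler_sum => k _.
exact: weight_mono (ltW bc).
Qed.

(** A partial sum of [S l] involves finitely many ordinals below [l], all of which already lie below
    some [b < l]. *)
Let S_limit l r : limit_ord l -> (forall b, (b < l)%O -> S b <= r) -> S l <= r.
Proof.
move=> [l0 lns] br; apply: S_le => n.
suff [b bl bn] : exists2 b, (b < l)%O &
    forall k, (k < n)%N -> hit l k -> hit b k.
  apply: le_trans (br b bl); apply: le_trans (psum_le b n).
  apply: ler_sum => k _; rewrite {1}/weight; case: ifPn => [hl|_].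
    by rewrite /weight (bn k).
  exact: weight_ge0.
elim: n => [|n [b bl bn]].
  by exists omega1_0 => //; rewrite lt_neqAle omega1_0P eq_sym l0.
have [/asboolP[c [cl cd] cn]|nh] := boolP (hit l n); last first.
  exists b => // k; rewrite ltnS leq_eqVlt => /orP[/eqP -> hl|].
    by rewrite hl in nh.
  exact: bn.
have [c' cc'] := succ_exists c.
have c'l : (c' < l)%O.
  by rewrite lt_neqAle (cc'.2 _ cl) andbT; apply/eqP => E; apply: (lns c);
    rewrite -E.
exists (Order.max b c'); first by rewrite gt_max bl.
move=> k; rewrite ltnS leq_eqVlt => /orP[/eqP -> _|kn hl].
  by apply/asboolP; exists c => //; rewrite lt_max cc'.1 orbT.
by apply: hit_mono (bn k kn hl); rewrite le_max lexx.
Qed.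

Lemma ordinal_embedding_aux : exists S : omega1 -> R,
  (forall b c, (b < c)%O -> (c <= d)%O -> S b < S c) /\
  (forall l r, limit_ord l -> (forall b, (b < l)%O -> S b <= r) -> S l <= r).
Proof. by exists S. Qed.

End OrdinalEmbedding.

Section Path.
Variable R : realType.
Local Notation ray := (long_ray R).

Lemma ordinal_embedding (d : omega1) : exists S : omega1 -> R,
  (forall b c, b < c -> c <= d -> (S b < S c)%R) /\
  (forall l r, limit_ord l -> (forall b, b < l -> (S b <= r)%R) ->
    (S l <= r)%R).
Proof.
have /countable_injP[e e_inj] := omega1_countable_below d.
exact: ordinal_embedding_aux e_inj.
Qed.

(** [phi] interpolates [S] linearly between each ordinal and its successor; it skips no value
    because [S] does not jump at limits. *)
Lemma initial_segment_embedding (d : omega1) : exists phi : ray -> R,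
  [/\ forall x y, x < y -> y <= ord_pt R d -> (phi x < phi y)%R &
      forall t, (phi (ray0 R) <= t <= phi (ord_pt R d))%R ->
        exists2 x, x <= ord_pt R d & phi x = t].
Proof.
have [S [S_lt S_lim]] := ordinal_embedding d.
have [sc scP] := choice succ_exists.
have S_le b c : b <= c -> c <= d -> (S b <= S c)%R.
  by rewrite le_eqVlt => /orP[/eqP -> //|bc cd]; exact/ltW/S_lt.
pose phi (x : ray) : R :=
  if x.1 < d then (S x.1 + val x.2 * (S (sc x.1) - S x.1))%R else S x.1.
have phi_ord b : phi (ord_pt R b) = S b.
  by rewrite /phi /=; case: ifP => // _; rewrite mul0r addr0.
have sc_le b : b < d -> sc b <= d by move=> bd; exact: (scP b).2.
have sc_lt b : b < d -> (S b < S (sc b))%R.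
  by move=> bd; apply: S_lt (sc_le _ bd); exact: (scP b).1.
exists phi; split=> [x y xy yd|t].
  have y1d : y.1 <= d by exact: ray_fst_le yd.
  have Sy : (S y.1 <= phi y)%R.
    rewrite /phi; case: ifPn => // y'd; have := sc_lt _ y'd => ?.
    by rewrite lerDl mulr_ge0 //; [case/andP: (valP y.2)|lra].
  move: xy; rewrite long_ray_ltE => /orP[xy|/andP[/eqP xy xy2]].
    have xd := lt_le_trans xy y1d; apply: lt_le_trans Sy.
    apply: lt_le_trans (S_le _ _ ((scP x.1).2 _ xy) y1d).
    rewrite /phi xd -ltrBrDl gtr_pMl ?subr_gt0 ?sc_lt //.
    by case/andP: (valP x.2).
  have yd' : y.1 < d.
    rewrite ltNge; apply/negP => dy.
    suff : x < x by rewrite ltxx.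
    apply: (@lt_le_trans _ _ (ord_pt R d)); last by rewrite ler_ord_pt xy.
    by apply: lt_le_trans yd; rewrite long_ray_ltE xy eqxx xy2 orbT.
  rewrite /phi xy yd' ltrD2l ltr_pM2r // subr_gt0; exact: sc_lt.
rewrite phi_ord ray0E phi_ord => /andP[t0];
  rewrite le_eqVlt => /orP[/eqP ->|td].
  by exists (ord_pt R d).
(* The least [b] with [t < S b] is neither 0 nor a limit, by [S_lim]; so it is the successor of some
   [c], and [t] lies on the segment from [S c] to [S b]. *)
have [b tb bmin] := @omega1_wf [set b | (t < S b)%R] (ex_intro _ d td).
have bd := bmin _ td.
have low c : c < b -> (S c <= t)%R.
  by move=> cb; rewrite leNgt; apply/negP => /bmin; rewrite leNgt cb.
have [c cb] : exists c, is_succ c b.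
  apply: contrapT => nc; move: (tb); rewrite /= ltNge S_lim //; split.
    by apply/eqP => b0; move: tb; rewrite /= b0 ltNge t0.
  by move=> y yb; apply: nc; exists y.
have scE : sc c = b.
  by apply/eqP; rewrite eq_le (scP c).2 ?cb.1 // cb.2 // (scP c).1.
have cd : c < d := lt_le_trans cb.1 bd.
have Scb : (S c < S b)%R by exact: S_lt cb.1 bd.
have ct := low _ cb.1.
have u01 : (0 <= (t - S c) / (S b - S c) < 1)%R.
  rewrite divr_ge0 ?subr_ge0 ?ltr_pdivrMr ?subr_gt0 ?mul1r ?ltrD2r //;
    last exact: ltW.
exists ((c, UnitIco u01) : ray).
  by apply: ltW; rewrite ltr_ord_pt.
rewrite /phi /= cd scE divfK ?subr_eq0 ?gt_eqF //; first by rewrite addrC subrK.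
Qed.

(** A monotone map onto an initial segment leaves no gap, so it cannot jump. *)
Lemma monotone_onto_continuous (c : R -> ray) (d : ray) :
  (forall s t, (s <= t)%R -> c s <= c t) -> (forall t, c t <= d) ->
  (forall x, x <= d -> exists t, c t = x) -> continuous c.
Proof.
move=> cm cd cs t.
have inv s u : c s < c u -> (s < u)%R.
  by move=> su; rewrite ltNge; apply/negP => /cm; rewrite leNgt su.
apply: cvg_order => [a|b] /ray_dense[m /andP[]].
  move=> am mc; have [s sm] := cs m (le_trans (ltW mc) (cd t)).
  have st : (s < t)%R by apply: inv; rewrite sm.
  near=> u; apply: lt_le_trans am _; rewrite -sm; apply: cm.
  by near: u; apply: filterS (lt_nbhsr st) => u /ltW.
move=> cm' mb; have [db|bd] := ltP d b.
  by near=> u; exact: le_lt_trans db.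
have [s sm] := cs m (le_trans (ltW mb) bd).
have ts : (t < s)%R by apply: inv; rewrite sm.
near=> u; apply: le_lt_trans mb; rewrite -sm; apply: cm.
by near: u; apply: filterS (lt_nbhsl ts) => u /ltW.
Unshelve. all: by end_near. Qed.

Lemma path_to_ray0 (d : omega1) : exists c : R -> ray,
  [/\ continuous c, c 0%R = ord_pt R d & c 1%R = ray0 R].
Proof.
have [phi [phi_lt phi_onto]] := initial_segment_embedding d.
set D := ord_pt R d in phi_lt phi_onto *.
have D0 : ray0 R <= D by exact: ray0P.
have phi_le x y : x <= y -> y <= D -> (phi x <= phi y)%R.
  by rewrite le_eqVlt => /orP[/eqP ->//|xy yD]; exact/ltW/phi_lt.
have phi_inj x y : x <= D -> y <= D -> phi x = phi y -> x = y.
  move=> xD yD E; case: (ltgtP x y) => // xy.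
    by have := phi_lt _ _ xy yD; rewrite E ltxx.
  by have := phi_lt _ _ xy xD; rewrite E ltxx.
(* The parameter is clamped to the range of [phi], so that the inverse [c] is defined on all of
   [R]. *)
have ex t : exists x, x <= D /\
    phi x = Num.max (phi (ray0 R)) (Num.min t (phi D)).
  have [|x xD xt] := phi_onto (Num.max (phi (ray0 R)) (Num.min t (phi D))).
    by rewrite le_max lexx ge_max phi_le // ge_min lexx orbT.
  by exists x.
have [c cP] := choice ex.
have cK x : x <= D -> c (phi x) = x.
  move=> xD; have [cD E] := cP (phi x); apply: phi_inj => //.
  by rewrite E min_l ?phi_le // max_r // phi_le // ray0P.
exists (c \o (fun t => phi D + t * (phi (ray0 R) - phi D))%R); split.
- move=> t; apply: continuous_comp.
    by apply: cvgD; [exact: cvg_cst | apply: cvgM;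
      [exact: cvg_id|exact: cvg_cst]].
  apply: (@monotone_onto_continuous c D) => [s u su|u|x xD].
  + rewrite leNgt; apply/negP => us.
    have := phi_lt _ _ us (cP s).1; rewrite (cP s).2 (cP u).2 ltNge.
    by rewrite ge_max !le_max lexx /= orbC le_min !ge_min lexx su orbT.
  + by case: (cP u).
  + by exists (phi x); exact: cK.
- by rewrite /= mul0r addr0 cK.
- by rewrite /= mul1r addrC subrK cK.
Qed.

End Path.

(** * Homotopy of maps controlling each other *)

Definition controls (R : realType) (X : Type) (f g : X -> long_ray R) : Prop :=
  forall e, exists h, forall x, f x <= ord_pt R e -> g x <= ord_pt R h.

Section CoarseControl.
Variables (R : realType) (X : topologicalType).
Local Notation ray := (long_ray R).
Implicit Types f g : continuousType X ray.

Lemma homotopic_below f g : (forall x, g x <= f x) -> controls g f ->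
  homotopic R f g.
Proof.
move=> gf /choice[h hP]; have [sc scP] := choice succ_exists.
(* [D] consists of the ordinals closed under the control function; by [Dgf], [g] below such an
   ordinal keeps [f] at most that ordinal. The successor [sc] turns the strict bound on [g x] into
   the weak one that control needs. *)
pose D : set omega1 := [set d | forall e, e < d -> h (sc e) < d].
have Dgf d x : D d -> g x < ord_pt R d -> f x <= ord_pt R d.
  move=> Dd; rewrite ltr_ord_pt => /Dd hd.
  apply: le_trans (_ : ord_pt R (h (sc (g x).1)) <= _).
    by apply: hP; apply: ltW; rewrite ltr_ord_pt; case: (scP (g x).1).
  by rewrite ord_pt_le ltW.
have next a : exists d, [/\ D d, a <= ord_pt R d &
    forall d', D d' -> a <= ord_pt R d' -> d <= d'].
  have [|d [Dd ad] dmin] := @omega1_wf [set d | D d /\ a <= ord_pt R d].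
    have [b ab] := ray_bound a; have [d bd Dd] := closed_ordinal (h \o sc) b.
    by exists d; split => //; rewrite (le_trans (ltW ab)) // ord_pt_le ltW.
  by exists d; split => // d' *; apply: dmin.
(* [f] and [g] lie in the same interval cut out by [D], whose right end is
   [u (f x)]: where [g x < f x], it is locally constant in [x];
     where they agree,
   the homotopy does not depend on the path. *)
have [u uP] := choice next; have [c cP] := choice (@path_to_ray0 R).
(* At time 0 the path is at [ord_pt R (u (f x)) >= f x], which leaves [f]; at time 1 it is at
   [ray0], which leaves [g]. *)
pose H (z : X * R) : ray :=
  Order.min (f z.1) (Order.max (g z.1) (c (u (f z.1)) z.2)).
have cf : continuous f by exact: cts_fun.
have cg : continuous g by exact: cts_fun.
(* Near [x], [g y] stays below [u (f x)], so [f y] is at most [u (f x)]; and [f y] stays above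
   [g x], so [g x] is below [u (f y)] and [f x] at most [u (f y)]. Minimality gives equality. *)
have uconst x : g x < f x -> \forall y \near x, u (f y) = u (f x).
  move=> gfx; have [Du ufx umin] := uP (f x).
  have gu := lt_le_trans gfx ufx; near=> y.
  have gy : g y < ord_pt R (u (f x)) by near: y; exact: cvg_near_lt (cg _) _.
  have fy : g x < f y by near: y; exact: cvg_near_gt (cf _) _.
  have [Dv vfy vmin] := uP (f y).
  apply/eqP; rewrite eq_le vmin //=; last exact: Dgf.
  by apply: umin => //; apply: Dgf => //; exact: lt_le_trans fy vfy.
have cf1 (z : X * R) : (fun w => f w.1) @ z --> f z.1.
  by apply: continuous_comp; [exact: cvg_fst | exact: cf].
have cg1 (z : X * R) : (fun w => g w.1) @ z --> g z.1.
  by apply: continuous_comp; [exact: cvg_fst | exact: cg].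
have uconst1 (z : X * R) :
    g z.1 < f z.1 -> \forall w \near z, u (f w.1) = u (f z.1).
  move=> /uconst; have : fst @ z --> z.1 by exact: cvg_fst.
  exact.
have csnd (z : X * R) d : (fun w => c d w.2) @ z --> c d z.2.
  by apply: continuous_comp; [exact: cvg_snd | case: (cP d) => + _ _; exact].
exists H; split => [|x|x].
- apply: continuous_subspaceT => z; apply: cvg_order => [a|b].
    rewrite /H lt_min lt_max => /andP[af aH].
    have nf := cvg_near_gt (cf1 z) af.
    have [ag|ga] := ltP a (g z.1).
      apply: filterS2 nf (cvg_near_gt (cg1 z) ag) => w afw agw.
      by rewrite lt_min lt_max afw agw.
    move: aH; rewrite ltNge ga /= => ac.
    have nu := uconst1 z (le_lt_trans ga af).
    apply: filterS3 nf nu (cvg_near_gt (csnd z _) ac) => w afw uw acw.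
    by rewrite lt_min lt_max afw uw acw orbT.
  rewrite /H gt_min; have [fb _|bf /=] := ltP (f z.1) b.
    apply: filterS (cvg_near_lt (cf1 z) fb) => w fw.
    by rewrite gt_min fw.
  rewrite gt_max => /andP[gb cb].
  have nu := uconst1 z (lt_le_trans gb bf).
  have ng := cvg_near_lt (cg1 z) gb.
  apply: filterS3 nu ng (cvg_near_lt (csnd z _) cb) => w uw gw cw.
  by rewrite gt_min gt_max uw gw cw orbT.
- rewrite /H /=; have [_ c0 _] := cP (u (f x)).
  by rewrite c0 min_l // le_max; have [_ ->] := uP (f x); rewrite orbT.
- rewrite /H /=; have [_ _ c1] := cP (u (f x)).
  by rewrite c1 max_l ?ray0P // min_r.
Unshelve. all: by end_near. Qed.

Lemma homotopic_controls f g : controls f g -> controls g f -> homotopic R f g.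
Proof.
move=> cfg cgf.
have cm : continuous (fun x => Order.min (f x) (g x)).
  by apply: min_fun_continuous; exact: cts_fun.
pose m : continuousType X ray := mkcts cm.
have mE x : m x = Order.min (f x) (g x) by [].
have mf : homotopic R f m.
  apply: homotopic_below => [x|e]; first by rewrite mE ge_min lexx.
  have [h hP] := cgf e; exists (Order.max e h) => x.
  rewrite mE ge_min => /orP[fe|/hP fh].
    by rewrite (le_trans fe) // ord_pt_le le_max lexx.
  by rewrite (le_trans fh) // ord_pt_le le_max lexx orbT.
apply: homotopic_trans mf _; apply: homotopic_sym.
apply: homotopic_below => [x|e]; first by rewrite mE ge_min lexx orbT.
have [h hP] := cfg e; exists (Order.max e h) => x.
rewrite mE ge_min => /orP[/hP fh|fe].
  by rewrite (le_trans fh) // ord_pt_le le_max lexx orbT.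
by rewrite (le_trans fe) // ord_pt_le le_max lexx.
Qed.

End CoarseControl.

(** * Bounded and unbounded maps *)

Section RayMaps.
Variable R : realType.
Local Notation ray := (long_ray R).
Local Notation ord_pt := (ord_pt R).
Implicit Types (x y c : ray) (F : ray -> ray) (f : ray * ray -> ray).

Definition bounded_map (T : Type) (F : T -> ray) : Prop :=
  exists b, forall t, F t <= b.

Definition cofinal2 (P : set (ray * ray)) : Prop :=
  forall e, exists z, [/\ P z, e < z.1.1 & e < z.2.1].

Lemma nbhs_ord_pt (d : omega1) (U : set ray) : omega1_0 < d ->
  nbhs (ord_pt d) U ->
  exists2 e, e < d & forall x, e < x.1 -> x < ord_pt d -> U x.
Proof.
move=> d0; rewrite itv_nbhsE => -[i [oi xi] iU].
case: i oi xi iU => [[[] a|[]] [[] b|[]]] //= _; rewrite in_itv /= ?andbT.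
- move=> /andP[ad db] iU; exists a.1; first by rewrite -(@ltr_ord_pt R).
  move=> x ax xd; apply: iU; rewrite /= in_itv /= (lt_trans xd db) andbT.
  by rewrite long_ray_ltE ax.
- move=> ad iU; exists a.1; first by rewrite -(@ltr_ord_pt R).
  by move=> x ax xd; apply: iU; rewrite /= in_itv /= long_ray_ltE ax.
- move=> db iU; exists omega1_0 => // x _ xd; apply: iU.
  by rewrite /= in_itv /= (lt_trans xd db).
- by move=> _ iU; exists omega1_0 => // x _ xd; apply: iU; rewrite /= in_itv.
Qed.

(** Leapfrog: for [d] closed under the choices of points in both sets, [(d, d)] is a limit of points
    of [P] and of points of [Q]. *)
Lemma cofinal_meet (P Q : set (ray * ray)) : closed P -> closed Q ->
  cofinal2 P -> cofinal2 Q -> exists z, P z /\ Q z.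
Proof.
move=> clP clQ /choice[p pP] /choice[q qP].
pose h e := Order.max (Order.max (p e).1.1 (p e).2.1)
                      (Order.max (q e).1.1 (q e).2.1).
have [d d0 hd] := closed_ordinal h omega1_0.
have cl (A : set (ray * ray)) (a : omega1 -> ray * ray) : closed A ->
    (forall e, [/\ A (a e), e < (a e).1.1 & e < (a e).2.1]) ->
    (forall e, e < d -> (a e).1.1 < d /\ (a e).2.1 < d) ->
    A (ord_pt d, ord_pt d).
  move=> clA aP ad; apply: clA => B [[U V] /= [nU nV] UV].
  have [eU eUd eUP] := nbhs_ord_pt d0 nU.
  have [eV eVd eVP] := nbhs_ord_pt d0 nV.
  pose e := Order.max eU eV; have ed : e < d by rewrite gt_max eUd.
  have [a1 a2] := ad e ed; have [Aa ea1 ea2] := aP e.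
  exists (a e); split => //; apply: UV; split => /=.
    by apply: eUP; rewrite ?ltr_ord_pt // (le_lt_trans _ ea1) // le_max lexx.
  by apply: eVP; rewrite ?ltr_ord_pt // (le_lt_trans _ ea2) // le_max lexx orbT.
exists (ord_pt d, ord_pt d); split.
  apply: (cl P p) => // e /hd.
  by rewrite /h !gt_max => /andP[/andP[-> ->]].
apply: (cl Q q) => // e /hd.
by rewrite /h !gt_max => /andP[_ /andP[-> ->]].
Qed.

Lemma not_cofinal_le_ge f c c' : continuous f -> c < c' ->
  cofinal2 [set z | f z <= c] -> cofinal2 [set z | c' <= f z] -> False.
Proof.
move=> cf cc' c1 c2.
have [z [/= fc cf']] :=
  cofinal_meet (closed_le_fun cf) (closed_ge_fun cf) c1 c2.
by move: (lt_le_trans cc' cf'); rewrite ltNge fc.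
Qed.

(** A bound common to a countable dense subset of the segment exists by regularity, and closedness
    extends it to the whole segment. *)
Lemma uniform_below (Pr : omega1 -> ray -> Prop) :
  (forall h h' y, h <= h' -> Pr h y -> Pr h' y) ->
  (forall h, closed [set y | Pr h y]) ->
  (forall y, exists h, Pr h y) ->
  forall d : omega1, exists h, forall y, y.1 < d -> Pr h y.
Proof.
move=> Pm Pc /choice[h hP] d; have [Q cQ Qd] := countable_dense R d.
have [b bP] := countable_family_bound h cQ.
exists b => y yd; apply: (Pc b) => B /Qd -/(_ yd)[q Qq Bq].
by exists q; split => //; apply: Pm (hP q); exact/ltW/bP.
Qed.

Lemma ord_pt_gt (e : omega1) : exists x, e < x.1.
Proof. by have [b eb] := omega1_gt e; exists (ord_pt b). Qed.

Lemma bounded_below F : continuous F ->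
  forall d : omega1, exists b, forall y, y.1 < d -> F y <= ord_pt b.
Proof.
move=> cF; apply: (@uniform_below (fun b y => F y <= ord_pt b)).
- by move=> h h' y hh' /le_trans; apply; rewrite ord_pt_le.
- by move=> h; exact: closed_le_fun.
- by move=> y; have [b /ltW yb] := ray_bound (F y); exists b.
Qed.

(** A continuous map is bounded on each initial segment, so its large values occur beyond any
    [e]. *)
Lemma unbounded_cofinal F : continuous F -> ~ bounded_map F ->
  forall c e, exists2 x, e < x.1 & c < F x.
Proof.
move=> cF nF c e; apply: contrapT => ne; apply: nF.
have [e' ee'] := omega1_gt e; have [b bP] := bounded_below cF e'.
exists (Order.max (ord_pt b) c) => x; rewrite le_max.
have [xe|ex] := ltP x.1 e'; first by rewrite bP.
rewrite orbC leNgt; case: ltP => // cx; case: ne.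
by exists x => //; exact: lt_le_trans ex.
Qed.

(** Otherwise [F] would be at most [c] cofinally and at least [c' > c] cofinally. Reading [F] as a
    map of the first coordinate, evaluated at points [(x, x)], reduces this to the leapfrog in the
    square. *)
Lemma unbounded_tends F : continuous F -> ~ bounded_map F ->
  forall c, exists e, forall x, e < x.1 -> c < F x.
Proof.
move=> cF nF c; apply: contrapT => ne; have [c' cc'] := long_ray_unbounded c.
have cF1 : continuous (F \o @fst ray ray).
  by move=> z; apply: continuous_comp; [exact: cvg_fst | exact: cF].
apply: (not_cofinal_le_ge cF1 cc') => e.
  apply: contrapT => nz; apply: ne; exists e => x ex.
  by rewrite ltNge; apply/negP => Fx; apply: nz; exists (x, x).
by have [x ex cx] := unbounded_cofinal cF nF c' e; exists (x, x); split=> //=;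
  exact: ltW.
Qed.

Lemma bounded_of_cofinal F c : continuous F ->
  (forall e, exists2 x, e < x.1 & F x <= c) -> bounded_map F.
Proof.
move=> cF Fc; apply: contrapT => /(unbounded_tends cF) /(_ c)[e eP].
by have [x /eP] := Fc e; rewrite ltNge => /negbTE ->.
Qed.

(* Pigeonhole over omega_1: each of uncountably many strict inequalities
   satisfied by [F p] persists on some [N n], hence uncountably many persist on
   the same [N n]. *)
Lemma bounded_near (P : Type) (N : nat -> set P) (p : P) (F : P -> ray -> ray) :
  (forall q, continuous (F q)) ->
  (forall x c, F p x < c -> exists n, forall q, N n q -> F q x < c) ->
  (forall x c, c < F p x -> exists n, forall q, N n q -> c < F q x) ->
  exists n, forall q, N n q -> (bounded_map (F q) <-> bounded_map (F p)).
Proof.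
move=> cF Fl Fg; have [bp|nbp] := pselect (bounded_map (F p)).
  have [b pb] := bp; have [c bc] := long_ray_unbounded b.
  have ex (e : omega1) : exists xn : ray * nat, e < xn.1.1 /\
      forall q, N xn.2 q -> F q xn.1 < c.
    have [x ex] := ord_pt_gt e; have [n nP] := Fl x c (le_lt_trans (pb x) bc).
    by exists (x, n).
  have [xn xnP] := choice ex; have [n nP] := pigeonhole (fun e => (xn e).2).
  exists n => q Nq; split => // _; apply: (bounded_of_cofinal (c := c)) => // e.
  have [e' ee' e'n] := nP e; have [ex' xq] := xnP e'.
  exists (xn e').1; first exact: le_lt_trans ee' ex'.
  by apply/ltW/xq; rewrite e'n.
(* Here the thresholds [ord_pt e] themselves grow, so a neighbourhood index shared by cofinally many
   [e] makes [F q] exceed every bound. *)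
have ex (e : omega1) : exists xn : ray * nat,
    forall q, N xn.2 q -> ord_pt e < F q xn.1.
  have [x _ ex] := unbounded_cofinal (cF p) nbp (ord_pt e) omega1_0.
  by have [n nP] := Fg x _ ex; exists (x, n).
have [xn xnP] := choice ex; have [n nP] := pigeonhole (fun e => (xn e).2).
exists n => q Nq; split => // -[b qb]; exfalso.
have [e be] := ray_bound b; have [e' ee' e'n] := nP e.
have : ord_pt e' < F q (xn e').1 by apply: xnP; rewrite e'n.
rewrite ltNge (le_trans (qb _)) // (le_trans (ltW be)) //.
by rewrite ord_pt_le.
Qed.

Lemma locally_constant (P : R -> Prop) :
  (forall t, \forall s \near t, P s <-> P t) -> forall s t, P s <-> P t.
Proof.
move=> loc s t.
have oP (Q : R -> Prop) :
    (forall t, \forall s \near t, Q s <-> Q t) -> open [set u | Q u].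
  move=> lQ; rewrite openE => u Qu; rewrite /interior.
  by apply: filterS (lQ u) => v; case=> _; exact.
have oN : open [set u | ~ P u].
  apply: oP => u; apply: filterS (loc u) => v PP; by rewrite PP.
have [Ps|nPs] := pselect (exists u, P u); last first.
  by split=> Pu; case: nPs; [exists s|exists t].
have /connected_intervalP cT : is_interval [set: R] by [].
suff /seteqP[_ sub] : [set u | P u] = [set: R].
  by split=> _; exact: sub.
apply: cT => //; exists [set u | P u]; rewrite ?setTI //; first exact: oP.
by rewrite -openC; exact: oN.
Qed.

(** Balls of radius [1/(n+1)] form a countable base at each time, so [bounded_near] makes
    boundedness locally constant in time; the line is connected. *)
Lemma bounded_homotopy_invariant (h : ray * R -> ray) s t : continuous h ->
  bounded_map (fun x => h (x, s)) <-> bounded_map (fun x => h (x, t)).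
Proof.
move=> ch; move: s t;
  apply: (@locally_constant (fun t => bounded_map (fun x => h (x, t)))) => t.
have chl u : continuous (fun x => h (x, u)).
  move=> x; apply: continuous_comp => //; last exact: ch.
  exact: (cvg_pair (@cvg_id _ (nbhs x)) (cvg_cst u)).
have chr x : (fun u => h (x, u)) @ t --> h (x, t).
  apply: continuous_comp => //; last exact: ch.
  exact: (cvg_pair (cvg_cst x) (@cvg_id _ (nbhs t))).
have base (A : set R) : (\forall u \near t, A u) ->
    exists n : nat, forall u, ball t (n.+1%:R^-1)%R u -> A u.
  move=> /nbhs_ballP[e /= e0 eA]; exists (Num.truncn e^-1)%R => u tu; apply: eA.
  apply: le_ball tu; rewrite invf_ple ?posrE //; exact/ltW/truncnS_gt.
have [n nP] := @bounded_near R (fun n => ball t (n.+1%:R^-1)%R) t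
  (fun u x => h (x, u)) chl
  (fun x c xc => base _ (cvg_near_lt (chr x) xc))
  (fun x c xc => base _ (cvg_near_gt (chr x) xc)).
apply: filterS (nbhsx_ballx t (n.+1%:R^-1)%R _); last by rewrite invr_gt0.
by move=> u /nP.
Qed.

End RayMaps.

(** * Maps on an octant *)

Lemma continuous_pair (X Y Z : topologicalType) (f : X -> Y) (g : X -> Z) :
  continuous f -> continuous g -> continuous (fun x => (f x, g x)).
Proof. by move=> cf cg x; exact: cvg_pair (cf x) (cg x). Qed.

Section OctantMaps.
Variable R : realType.
Local Notation ray := (long_ray R).
Local Notation oct := (octant R).
Implicit Types (x y c : ray) (f g : oct -> ray).

Definition oct_pt x y (h : y <= x) : oct :=
  exist _ (x, y) (mem_set (h : octant_set (x, y))).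

Definition oct_height (c : oct) : ray := (oct_coords c).2.

Lemma le_max_snd (z : ray * ray) : z.2 <= Order.max z.1 z.2.
Proof. by rewrite le_max lexx orbT. Qed.

(** The retraction of the square onto the octant. It extends a map on the octant to the square,
    where the cofinality lemmas apply. *)
Definition oct_retract (z : ray * ray) : oct := oct_pt (le_max_snd z).

Lemma oct_retractK (c : oct) : oct_retract (oct_coords c) = c.
Proof.
apply: oct_coords_inj; rewrite /= max_l ?oct_coordsP //.
by rewrite -surjective_pairing.
Qed.

Lemma continuous_oct_coords : continuous (@oct_coords R).
Proof. exact: initial_continuous. Qed.

Lemma continuous_oct_radius : continuous (@oct_radius R).
Proof.
by move=> c; apply: continuous_comp;
  [exact: continuous_oct_coords | exact: cvg_fst].
Qed.

Lemma continuous_oct_height : continuous oct_height.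
Proof.
by move=> c; apply: continuous_comp;
  [exact: continuous_oct_coords | exact: cvg_snd].
Qed.

Lemma continuous_oct_retract : continuous oct_retract.
Proof.
apply: (@continuous_comp_initial oct (ray * ray)%type).
apply: (@continuous_pair _ _ _ (fun z : ray * ray => Order.max z.1 z.2) snd).
  exact: max_continuous.
by move=> z; exact: cvg_snd.
Qed.

Definition on_horizontal f x : ray := f (oct_retract (x, ray0 R)).
Definition on_diagonal f x : ray := f (oct_retract (x, x)).

Section OneMap.
Variable f : oct -> ray.
Hypothesis cf : continuous f.
Let F (z : ray * ray) : ray := f (oct_retract z).

Let cF : continuous F.
Proof.
by move=> z; apply: continuous_comp;
  [exact: continuous_oct_retract | exact: cf].
Qed.

Let crow y : continuous (fun x => F (x, y)).
Proof.
move=> x; apply: continuous_comp; last exact: cF.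
exact: (cvg_pair (@cvg_id _ (nbhs x)) (cvg_cst y)).
Qed.

Let ccol x : continuous (fun y => F (x, y)).
Proof.
move=> y; apply: continuous_comp; last exact: cF.
exact: (cvg_pair (cvg_cst x) (@cvg_id _ (nbhs y))).
Qed.

Let F_coords (c : oct) : F (oct_coords c) = f c.
Proof. by rewrite /F oct_retractK. Qed.

Lemma continuous_on_diagonal : continuous (on_diagonal f).
Proof.
move=> x; apply: (@continuous_comp _ _ _ (fun x : ray => (x, x)) F);
  last exact: cF.
exact: (cvg_pair (@cvg_id _ (nbhs x)) (@cvg_id _ (nbhs x))).
Qed.

Let bounded_row y :
  bounded_map (fun x => F (x, y)) <-> bounded_map (on_horizontal f).
Proof.
have [d yd] := ray_bound y; have [c [cc c0 c1]] := path_to_ray0 R d.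
(* A path from [d > y] down to 0, clipped at height [y], is a homotopy from row [y] to the
   horizontal edge. *)
pose h (z : ray * R) := F (z.1, Order.min (c z.2) y).
have ch : continuous h.
  move=> z; apply: continuous_comp; last exact: cF.
  apply: (@continuous_pair _ _ _ (fun z : ray * R => z.1)
    (fun z : ray * R => Order.min (c z.2) y)) => {}z.
    exact: cvg_fst.
  apply: (@min_fun_continuous _ _ _ (fun z : ray * R => c z.2) (cst y)) => {}z.
    by apply: continuous_comp; [exact: cvg_snd | exact: cc].
  exact: cvg_cst.
have := bounded_homotopy_invariant 0%R 1%R ch.
rewrite /h /= c0 c1 min_r ?(ltW yd) // min_l ?ray0P //.
Qed.

(** The diagonal enters every corner, so large values are cofinal; if values at most [c] were
    cofinal too, [not_cofinal_le_ge] would be contradicted. *)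
Let corner_unbounded : ~ bounded_map (on_diagonal f) ->
  forall c, exists e, forall x y, e < x.1 -> e < y.1 -> c < F (x, y).
Proof.
move=> nd c; apply: contrapT => ne; have [c' cc'] := long_ray_unbounded c.
apply: (not_cofinal_le_ge cF cc') => e.
  apply: contrapT => nz; apply: ne; exists e => x y ex ey.
  by rewrite ltNge; apply/negP => Fx; apply: nz; exists (x, y).
have [x ex cx] := unbounded_cofinal continuous_on_diagonal nd c' e.
by exists (x, x); split => //=; exact: ltW.
Qed.

Let corner_bounded : bounded_map (on_diagonal f) ->
  exists c e, forall x y, e < x.1 -> e < y.1 -> F (x, y) <= c.
Proof.
move=> [b db]; have [c bc] := long_ray_unbounded b; exists c.
apply: contrapT => ne; apply: (not_cofinal_le_ge cF bc) => e.
  have [x ex] := ord_pt_gt R e; exists (x, x); split => //; exact: db.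
apply: contrapT => nz; apply: ne; exists e => x y ex ey.
rewrite leNgt; apply/negP => Fx; apply: nz; exists (x, y); split => //.
exact: ltW.
Qed.

(** A row high enough ends inside the corner on which [f] is bounded, and by [bounded_row] all rows
    behave like the horizontal edge. *)
Lemma bounded_horizontal :
  bounded_map (on_diagonal f) -> bounded_map (on_horizontal f).
Proof.
move=> /corner_bounded[c [e eP]]; have [y ey] := ord_pt_gt R e.
apply/(bounded_row y); apply: bounded_of_cofinal => [|d]; first exact: crow.
have [x dx] := ord_pt_gt R (Order.max d e); move: dx;
  rewrite gt_max => /andP[dx ex].
by exists x; last exact: eP.
Qed.

(** A bound on the radius bounds both coordinates; [f] is then bounded along each row, and
    [uniform_below] makes the bound common to the rows. *)
Lemma radius_controls : controls (@oct_radius R) f.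
Proof.
move=> e; have [d ed] := omega1_gt e.
have [|||h hP] := @uniform_below R
    (fun h y => forall x, x.1 < d -> F (x, y) <= ord_pt R h) _ _ _ d.
- by move=> h h' y hh' hy x xd; rewrite (le_trans (hy x xd)) // ord_pt_le.
- move=> h; rewrite [X in closed X](_ : _ =
      \bigcap_(x in [set x : ray | x.1 < d]) [set y | F (x, y) <= ord_pt R h]).
    by apply: closed_bigI => x _; apply: closed_le_fun; exact: ccol.
  by apply/seteqP; split.
- by move=> y; exact: bounded_below (@crow y) d.
exists h => c ce; rewrite -F_coords [oct_coords c]surjective_pairing.
have xd : (oct_coords c).1.1 < d.
  by apply: le_lt_trans ed; exact: (ray_fst_le ce).
apply: hP => //; apply: le_lt_trans xd; exact: ray_fst_le (oct_coordsP c).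
Qed.

Let rows_bounded : bounded_map (on_horizontal f) ->
  forall d : omega1, exists h, forall y, y.1 < d ->
    forall x, F (x, y) <= ord_pt R h.
Proof.
move=> bh; apply: (@uniform_below R (fun h y =>
  forall x, F (x, y) <= ord_pt R h)).
- by move=> h h' y hh' hy x; rewrite (le_trans (hy x)) // ord_pt_le.
- move=> h; rewrite [X in closed X](_ : _ =
      \bigcap_(x in [set: ray]) [set y | F (x, y) <= ord_pt R h]).
    by apply: closed_bigI => x _; apply: closed_le_fun; exact: ccol.
  by apply/seteqP; split => y /= yP x; [move=> _|]; exact: yP.
- move=> y; have /(bounded_row y)[b yb] := bh; have [h bh'] := ray_bound b.
  by exists h => x; rewrite (le_trans (yb x)) // ltW.
Qed.

Lemma height_controls :
  bounded_map (on_horizontal f) -> controls oct_height f.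
Proof.
move=> bh e; have [d ed] := omega1_gt e; have [h hP] := rows_bounded bh d.
exists h => c ce; rewrite -F_coords [oct_coords c]surjective_pairing.
by apply: hP; apply: le_lt_trans ed; exact: (ray_fst_le ce).
Qed.

Lemma controls_height :
  ~ bounded_map (on_diagonal f) -> controls f oct_height.
Proof.
move=> nd e; have [d dP] := corner_unbounded nd (ord_pt R e).
have [h dh] := omega1_gt d; exists h => c fc; rewrite leNgt; apply/negP => hc.
have dy : d < (oct_height c).1.
  by apply: lt_le_trans dh _; exact: ray_fst_le (ltW hc).
have dx : d < (oct_radius c).1.
  by apply: lt_le_trans dy _; exact: ray_fst_le (oct_coordsP c).
have := dP _ _ dx dy; rewrite ltNge -[(_, _)]surjective_pairing.
by rewrite [F _]F_coords fc.
Qed.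

(** Far out, high points are in the corner where [f] is large; each of the remaining rows tends to
    infinity, and [uniform_below] makes this uniform in the row. *)
Lemma controls_radius :
  ~ bounded_map (on_horizontal f) -> controls f (@oct_radius R).
Proof.
move=> nh e; have nd : ~ bounded_map (on_diagonal f).
  by move/bounded_horizontal.
have [d dP] := corner_unbounded nd (ord_pt R e).
(* Uniformity needs a closed condition, hence a weak inequality at some [e' > e]; cutting the rows
   at [d' > d] puts those from [d'] on strictly inside the corner. *)
have [d' dd'] := omega1_gt d; have [e' ee'] := omega1_gt e.
have [|||h hP] := @uniform_below R
    (fun h y => forall x, h < x.1 -> ord_pt R e' <= F (x, y)) _ _ _ d'.
- by move=> h h' y hh' hy x xh; apply: hy; exact: le_lt_trans xh.
- move=> h; rewrite [X in closed X](_ : _ =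
      \bigcap_(x in [set x : ray | h < x.1]) [set y | ord_pt R e' <= F (x, y)]).
    by apply: closed_bigI => x _; apply: closed_ge_fun; exact: ccol.
  by apply/seteqP; split.
- move=> y; have nr : ~ bounded_map (fun x => F (x, y)) by move/bounded_row.
  have [h hP] := unbounded_tends (@crow y) nr (ord_pt R e').
  by exists h => x /hP /ltW.
have [k hk] := omega1_gt (Order.max h d).
move: hk; rewrite gt_max => /andP[hk dk].
exists k => c; apply: contraTT; rewrite -!ltNge => kc.
have kx : k <= (oct_radius c).1 by exact: ray_fst_le (ltW kc).
rewrite -F_coords [oct_coords c]surjective_pairing.
have [yd|dy] := ltP (oct_height c).1 d'.
  apply: lt_le_trans (hP _ yd _ (lt_le_trans hk kx)).
  by rewrite ord_pt_lt.
by apply: dP; [exact: lt_le_trans dk kx | exact: lt_le_trans dd' dy].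
Qed.

Lemma bounded_octant_map : bounded_map (on_horizontal f) ->
  bounded_map (on_diagonal f) -> bounded_map f.
Proof.
move=> bh /corner_bounded[b [d dP]]; have [d' dd'] := omega1_gt d.
have [h hP] := rows_bounded bh d'; exists (Order.max b (ord_pt R h)) => c.
rewrite -F_coords [oct_coords c]surjective_pairing le_max.
have [yd|dy] := ltP (oct_height c).1 d'; first by rewrite hP // orbT.
have dx : d' <= (oct_radius c).1.
  by apply: le_trans dy _; exact: ray_fst_le (oct_coordsP c).
by rewrite dP //; [exact: lt_le_trans dd' dx | exact: lt_le_trans dd' dy].
Qed.

End OneMap.

Lemma controls_trans (T : Type) (f g h : T -> ray) :
  controls f g -> controls g h -> controls f h.
Proof.
move=> fg gh e; have [e' fe] := fg e; have [e'' ge] := gh e'.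
by exists e'' => x /fe /ge.
Qed.

(** The comparison passes through a model: the height if [g] is bounded on the horizontal edge only,
    the radius if it is unbounded there. If [g] is bounded on both edges it is bounded, and nothing
    is left to compare. *)
Lemma octant_controls f g : continuous f -> continuous g ->
  (bounded_map (on_horizontal f) <-> bounded_map (on_horizontal g)) ->
  (bounded_map (on_diagonal f) <-> bounded_map (on_diagonal g)) ->
  controls f g.
Proof.
move=> cf cg Eh Ed; have [bh|nh] := pselect (bounded_map (on_horizontal g)).
  have [bd|nd] := pselect (bounded_map (on_diagonal g)).
    have [b gb] := bounded_octant_map cg bh bd; have [h bh'] := ray_bound b.
    by move=> e; exists h => x _; rewrite (le_trans (gb x)) // ltW.
  apply: controls_trans (height_controls cg bh); apply: controls_height => //.
  by move/Ed.
apply: controls_trans (radius_controls cg); apply: controls_radius => //.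
by move/Eh.
Qed.

End OctantMaps.

(** * Maps on the surface *)

Definition flip (d : direction) : direction := if d is Up then Down else Up.

Section SurfaceMaps.
Variables (R : realType) (alpha : omega1) (s : below alpha -> direction).
Local Notation ray := (long_ray R).
Local Notation oct := (octant R).
Local Notation M := (surface R s).
Local Notation surf_pt := (@surf_pt R alpha s).
Implicit Types (x y : ray) (g h : below alpha) (f : M -> ray).

Definition edge_pt (d : direction) x : oct :=
  oct_retract (x, if d is Up then ray0 R else x).

Lemma edge_pt_radius d x : oct_radius (edge_pt d x) = x.
Proof. by rewrite /oct_radius /=; case: d;
  rewrite ?maxxx // max_l // ray0P. Qed.

Lemma bottom_edge_pt d x : bottom_edge d (edge_pt d x).
Proof.
by case: d => //; exact: esym (maxxx x).
Qed.

Lemma bottom_edgeE d (c : oct) :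
  bottom_edge d c -> c = edge_pt d (oct_radius c).
Proof.
by move=> dc; apply: bottom_edge_inj dc (bottom_edge_pt _ _) _;
  rewrite edge_pt_radius.
Qed.

Lemma top_edge_flip d : top_edge d = bottom_edge (flip d) :> set oct.
Proof. by case: d. Qed.

Lemma surf_pt_radius g (c : oct) : surf_radius (surf_pt g c) = oct_radius c.
Proof. exact: radius_pi. Qed.

Lemma surf_ptP (p : M) : exists g c, p = surf_pt g c.
Proof.
by exists (tag (repr p)), (tagged (repr p)); rewrite -[LHS]reprK;
  case: (repr p).
Qed.

Lemma surf_pt_eq g h (c d : oct) :
  surf_pt g c = surf_pt h d <-> glued s (octant_pt g c) (octant_pt h d).
Proof. exact: pi_glued. Qed.

Definition edge_of g x : M := surf_pt g (edge_pt (s g) x).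

Lemma edge_of_radius g x : surf_radius (edge_of g x) = x.
Proof. by rewrite surf_pt_radius edge_pt_radius. Qed.

Lemma Delta_edge_of g x : Delta g (edge_of g x).
Proof. by exists (edge_pt (s g) x) => //; exact: bottom_edge_pt. Qed.

Lemma DeltaP g (p : M) : Delta g p <-> p = edge_of g (surf_radius p).
Proof.
split=> [[c bc <-]|->]; last exact: Delta_edge_of.
by rewrite /edge_of surf_pt_radius -bottom_edgeE.
Qed.

Lemma edge_of_next g h x : next_octant g h ->
  surf_pt g (edge_pt (flip (s g)) x) = edge_of h x.
Proof.
move=> gh; apply/surf_pt_eq; apply: Or43; split => //=.
- by rewrite top_edge_flip; exact: bottom_edge_pt.
- exact: bottom_edge_pt.
- by rewrite [RHS]edge_pt_radius [LHS]edge_pt_radius.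
Qed.

Lemma surf_pt_ray0 g h (c d : oct) : oct_radius c = ray0 R ->
  oct_radius d = ray0 R -> surf_pt g c = surf_pt h d.
Proof.
by move=> c0 d0; apply/surf_pt_eq; apply: Or42; split; apply/is_originE.
Qed.

Lemma limit_not_succ g h b : ~ finite_ord alpha -> limit_ord b -> star b h ->
  ~ next_octant g h.
Proof.
move=> inf lb st n; have sgh := next_infinite inf n; case: st => [hb|[_ h0]].
  by apply: (lb.2 (val g)); rewrite -hb.
by have := sgh.1; rewrite h0 ltNge omega1_0P.
Qed.

Lemma continuous_surf_pt g : continuous (surf_pt g).
Proof.
apply/continuousP => U oU; have [fU iU] : surface_open U := oU.
have [fin|inf] := pselect (finite_ord alpha).
  have oV := fU fin.
  have /continuousP := @existT_continuous _ (fun _ : below alpha => oct) g.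
  by move=> /(_ _ oV).
rewrite openE => c Uc; rewrite /interior.
have [B pB BU] := iU inf _ Uc.
suff : nbhs c (surf_pt g @^-1` B) by apply: filterS => ? /BU.
case: pB {BU} => [e ap e0|B' nap nl nb|lam h m a b V lim lea st Dp ml ar rb oV
  tV bV].
- have : \forall d \near c, oct_radius d < e.
    apply: cvg_near_lt (@continuous_oct_radius R c) _.
    by move/apex_radius: ap; rewrite surf_pt_radius => ->.
  by apply: filterS => d; rewrite /= surf_pt_radius.
- have := nb (octant_pt g c) erefl; exact: existT_continuous.
- have c0 : oct_radius c <> ray0 R.
    by move=> E; move: ar; rewrite surf_pt_radius E ltNge ray0P.
  (* The point lies on a limit edge and is not the apex, so [h] is the only octant that contains it:
     no top edge is glued to a limit edge, and the two edges of [h] meet only at the apex. *)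
  suff Vc : g = h /\ V c.
    have gh := Vc.1; subst h.
    have := open_nbhs_nbhs (conj oV Vc.2 : open_nbhs c V).
    by apply: filterS => d Vd; left; exists d.
  have [d bd dE] := Dp; have /surf_pt_eq := esym dE.
  case=> [[E1 E2]|[/is_originE]//|[/= n _ _ _]|[/= _ td _ r]].
  + subst h; split => //.
    have : (V `&` bottom_edge (s g)) c.
      rewrite bV; split; first by rewrite E2.
      by rewrite -(surf_pt_radius g) ar.
    by case.
  + by case: (limit_not_succ inf lim st n).
  + by case: c0; rewrite -r; exact: bottom_top_edge bd td.
Qed.

Lemma continuous_edge_pt d : continuous (edge_pt d).
Proof.
move=> x; apply: (@continuous_comp _ _ _
  (fun x : ray => (x, if d is Up then ray0 R else x)) (@oct_retract R)).
  apply: (@continuous_pair _ _ _ id (fun x : ray =>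
    if d is Up then ray0 R else x)).
    by move=> ?; exact: cvg_id.
  by case: d; [exact: cst_continuous | move=> ?; exact: cvg_id].
exact: continuous_oct_retract.
Qed.

Lemma continuous_edge_of g : continuous (edge_of g).
Proof.
move=> x; apply: continuous_comp; first exact: continuous_edge_pt.
exact: continuous_surf_pt.
Qed.

Lemma unbounded_indicesP f g :
  unbounded_indices f g <-> ~ bounded_map (f \o edge_of g).
Proof.
rewrite /unbounded_indices /=; split=> nb [b bP]; apply: nb; exists b.
  by move=> p /DeltaP ->; exact: bP.
by move=> x; apply: bP; exact: Delta_edge_of.
Qed.

Lemma indices_bottom f g :
  unbounded_indices f g <-> ~ bounded_map (f \o surf_pt g \o edge_pt (s g)).
Proof. exact: unbounded_indicesP. Qed.

Lemma indices_top f g h : next_octant g h ->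
  unbounded_indices f h <->
    ~ bounded_map (f \o surf_pt g \o edge_pt (flip (s g))).
Proof.
move=> gh; rewrite unbounded_indicesP.
suff -> : f \o edge_of h = f \o surf_pt g \o edge_pt (flip (s g)) by [].
by apply/funext => x /=; rewrite (edge_of_next x gh).
Qed.

Lemma continuous_on_octant f g : continuous f -> continuous (f \o surf_pt g).
Proof.
move=> cf c; apply: continuous_comp; first exact: continuous_surf_pt.
exact: cf.
Qed.

(** * The set of indices: complete homotopy invariant, always adapted *)

Section Indices.
Hypothesis halpha : (alpha <> omega1_0 /\ finite_ord alpha) \/ limit_ord alpha.

Lemma next_exists g : exists h, next_octant g h.
Proof.
have [y gy] := succ_exists (val g).
have := gy.2 _ (valP g); rewrite le_eqVlt => /orP[/eqP ya|ya]; last first.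
  by exists (exist _ y ya); left.
case: halpha => [[a0 fin]|[_ nsucc]]; last first.
  by rewrite ya in gy; case: (nsucc (val g)).
have a0' : omega1_0 < alpha.
  by rewrite lt_neqAle omega1_0P andbT; apply/eqP => E; apply: a0.
by exists (exist _ omega1_0 a0'); right; split => //; rewrite ya in gy.
Qed.

Lemma countable_below : countable [set: below alpha].
Proof.
have /countable_injP[e e_inj] := omega1_countable_below alpha.
apply/countable_injP; exists (e \o val) => g h _ _ E; apply: val_inj.
by apply: e_inj E; rewrite inE /=; [exact: (valP g) | exact: (valP h)].
Qed.

Lemma controls_of_indices f f' : continuous f -> continuous f' ->
  unbounded_indices f = unbounded_indices f' -> controls f f'.
Proof.
move=> cf cf' E; have oc g : controls (f \o surf_pt g) (f' \o surf_pt g).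
  have [h gh] := next_exists g.
  have Eb : bounded_map (f \o surf_pt g \o edge_pt (s g)) <->
            bounded_map (f' \o surf_pt g \o edge_pt (s g)).
    by rewrite -[X in X <-> _]notK -[X in _ <-> X]notK -!indices_bottom E.
  have Et : bounded_map (f \o surf_pt g \o edge_pt (flip (s g))) <->
            bounded_map (f' \o surf_pt g \o edge_pt (flip (s g))).
    by rewrite -[X in X <-> _]notK -[X in _ <-> X]notK -!(indices_top _ gh) E.
  apply: octant_controls; [exact: continuous_on_octant|
    exact: continuous_on_octant| |].
    by move: Eb Et; case: (s g).
  by move: Eb Et; case: (s g).
move=> e; have /choice[k kP] := fun g => oc g e.
have [b bP] := countable_family_bound k countable_below.
exists b => p; have [g [c ->]] := surf_ptP p => /(kP g c) /le_trans; apply.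
by rewrite ord_pt_le ltW // bP.
Qed.

Lemma homotopic_of_indices (f f' : continuousType M ray) :
  unbounded_indices f = unbounded_indices f' -> homotopic R f f'.
Proof.
move=> E; apply: homotopic_controls; apply: controls_of_indices => //;
  exact: cts_fun.
Qed.

Lemma indices_of_homotopic (f f' : continuousType M ray) :
  homotopic R f f' -> unbounded_indices f = unbounded_indices f'.
Proof.
move=> [H [cH H0 H1]].
(* The formula clamps [t] to [0,1]; it extends a homotopy given on [0,1] to all real times, as
   [bounded_homotopy_invariant] requires. *)
pose phi (t : R) : R := ((`|t| - `|t - 1| + 1) / 2)%R.
have cphi : continuous phi.
  move=> t; apply: cvgM; last exact: cvg_cst.
  apply: cvgD; last exact: cvg_cst.
  apply: cvgB; apply: cvg_norm; first exact: cvg_id.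
  by apply: cvgB; [exact: cvg_id | exact: cvg_cst].
have phi01 (t : R) : [set: R] t -> `[0%R, 1%R]%classic (phi t).
  move=> _; rewrite /phi /= in_itv /=.
  by case: (ger0P t) => t0; case: (ger0P (t - 1)%R) => t1; apply/andP; split;
    lra.
have phi0 : phi 0%R = 0%R.
  by rewrite /phi normr0 add0r sub0r normrN normr1 addNr mul0r.
have phi1 : phi 1%R = 1%R.
  by rewrite /phi normr1 subrr normr0 subr0 divff ?pnatr_eq0.
have /subspace_continuousP cK := within_reparam cphi phi01 cH.
have {}cK : continuous (fun z : M * R => H (z.1, phi z.2)).
  move=> z; have := cK z (conj I I); rewrite setXTT.
  move=> cKz U /cKz nU; apply: (@filterS _ (nbhs z) _ _ _ _ nU) => w Uw.
  exact: Uw.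
apply/seteqP; suff E g : unbounded_indices f g <-> unbounded_indices f' g.
  by split=> g; apply E.
rewrite !unbounded_indicesP.
pose h (z : ray * R) := H (edge_of g z.1, phi z.2).
have ch : continuous h.
  move=> z; apply: (@continuous_comp _ _ _ (fun z : ray * R =>
    (edge_of g z.1, z.2))
    (fun z : M * R => H (z.1, phi z.2))); last exact: cK.
  apply: (@continuous_pair _ _ _ (fun z : ray * R => edge_of g z.1) snd) => {}z.
    by apply: continuous_comp; [exact: cvg_fst | exact: continuous_edge_of].
  exact: cvg_snd.
have := bounded_homotopy_invariant 0%R 1%R ch.
have -> : (fun x => h (x, 0%R)) = f \o edge_of g.
  by apply/funext => x; rewrite /h /= phi0 H0.
have -> : (fun x => h (x, 1%R)) = f' \o edge_of g.
  by apply/funext => x; rewrite /h /= phi1 H1.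
by move=> ->.
Qed.

(** Each generating step of [prec] leads from the horizontal to the diagonal edge of a single
    octant, so [bounded_horizontal] applies in contrapositive form. *)
Lemma indices_upward f g h : continuous f ->
  unbounded_indices f g -> prec s g h -> unbounded_indices f h.
Proof.
move=> cf + gh; elim: gh => {g h} [g h|//|g k h _ IH1 _ IH2]; last first.
  by move=> /IH1 /IH2.
case=> [[gh sg]|[hg sh]].
  rewrite indices_bottom (indices_top _ gh) sg => nb bd; apply: nb.
  exact: (@bounded_horizontal _ _ (@continuous_on_octant f g cf) bd).
rewrite (indices_top _ hg) indices_bottom sh => nb bd; apply: nb.
exact: (@bounded_horizontal _ _ (@continuous_on_octant f h cf) bd).
Qed.

Lemma limit_le_infinite b : limit_ord b -> b <= alpha -> ~ finite_ord alpha.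
Proof.
move=> lb ba fin; apply: (limit_infinite lb).
by apply: sub_finite_set fin => y /= /lt_le_trans; exact.
Qed.

Lemma star_exists b : limit_ord b -> b <= alpha ->
  exists g : below alpha, star b g.
Proof.
move=> lb; rewrite le_eqVlt => /orP[/eqP ba|ba].
  have a0 : omega1_0 < alpha by rewrite -ba; exact: limit_gt0.
  by exists (exist _ omega1_0 a0); right.
by exists (exist _ b ba); left.
Qed.

Lemma star_unique b g h : star b g -> star b h -> g = h.
Proof.
move=> bg bh; apply: val_inj; case: bg bh => [gb|[ba g0]] [hb|[ba' h0]].
- by rewrite gb hb.
- by have := valP g; rewrite gb ba' ltxx.
- by have := valP h; rewrite hb ba ltxx.
- by rewrite g0 h0.
Qed.

(** A neighbourhood of a point on a limit edge contains a full band of the octants accumulating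
    there, hence their edge points of the same radius; at the apex all these edge points
    coincide. *)
Lemma open_near_limit_edge (U : set M) b g x : open U -> limit_ord b ->
  b <= alpha -> star b g -> U (edge_of g x) ->
  exists2 m : omega1, m < b & forall q, m < val q < b -> U (edge_of q x).
Proof.
move=> oU lb ba bg Ug; have [_ iU] : surface_open U := oU.
have inf := limit_le_infinite lb ba; have [B pB BU] := iU inf _ Ug.
case: pB BU => [e ap e0 _|B' nap nl _ _|lam h m c d V lim lea st Dp ml ar rb oV
  tV bV BU].
- exists omega1_0 => [|q _]; first exact: limit_gt0.
  have x0 : x = ray0 R by move/apex_radius: ap; rewrite edge_of_radius.
  suff -> : edge_of q x = edge_of g x by [].
  by apply: surf_pt_ray0; rewrite edge_pt_radius.
- by case: nl; exists b, g; split => //; exact: Delta_edge_of.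
- have nap y : x = y -> c < y by move=> <-; rewrite edge_of_radius in ar.
  have nap' q : ~ is_apex (edge_of q x).
    by move=> /apex_radius; rewrite edge_of_radius => /nap; rewrite ltNge ray0P.
  have hE := Delta_inj (nap' g) inf Dp (Delta_edge_of g x); subst h.
  have lE := star_inj lim lb st bg; subst lam.
  exists (val m) => // q /andP[mq qb]; apply: BU; right; split; last first.
    by move: ar rb; rewrite /= !edge_of_radius => -> ->.
  split; first by exists q; [rewrite /= (ltW mq)|exists (edge_pt (s q) x)].
  (* The band omits [Delta m]; the point on edge [q] is not lost, since [q] differs from [m] and
     distinct edges meet only at the apex. *)
  move=> Dm; have E := Delta_inj (nap' q) inf Dm (Delta_edge_of q x).
  by move: mq; rewrite E ltxx.
Qed.

Lemma indices_adapted f : continuous f -> adapted s (unbounded_indices f).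
Proof.
move=> cf; split=> [g h ug|b lb ba]; first exact: indices_upward.
have [p bp] := star_exists lb ba.
have /countable_injP[e e_inj] := omega1_countable_below b.
(* A countable base of left neighbourhoods of [b]: [N n] is the interval between the ordinal
   numbered [n] by [e] and [b], or everything below [b] when no ordinal has that number. *)
pose N (n : nat) : set (below alpha) :=
  [set q | val q < b /\ forall y : omega1, y < b -> e y = n -> y < val q].
have near (U : set ray) x : open U -> U (f (edge_of p x)) ->
    exists n, forall q, N n q -> U (f (edge_of q x)).
  move=> oU Up; have oV : open (f @^-1` U) by move/continuousP: cf; exact.
  have [m mb mP] := open_near_limit_edge oV lb ba bp Up.
  by exists (e m) => q [qb qP]; apply: mP; rewrite qb qP.
have [|||n nP] := @bounded_near R (below alpha) N p (fun q => f \o edge_of q).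
- move=> q x; apply: continuous_comp; first exact: continuous_edge_of.
  exact: cf.
- move=> x c xc; have [|n nP] := near [set y | y < c] x _ xc; last by exists n.
  by rewrite -[X in open X]set_itvNyo; exact: lray_open.
- move=> x c xc; have [|n nP] := near [set y | c < y] x _ xc; last by exists n.
  by rewrite -[X in open X]set_itvoy; exact: rray_open.
(* [adapted] asks for a closed left end, so [gb] is the successor of the ordinal numbered [n], still
   below the limit [b]. *)
have [gb gbb gbP] : exists2 gb : omega1, gb < b &
    forall y : omega1, y < b -> e y = n -> y < gb.
  have [[y yb yn]|ny] := pselect (exists2 y : omega1, y < b & e y = n).
    have [z yz] := succ_exists y; exists z; first exact: limit_succ_lt yz yb.
    move=> y' y'b y'n; suff -> : y' = y by exact: yz.1.
    by apply: e_inj; rewrite ?inE // yn.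
  exists omega1_0 => [|y yb yn]; first exact: limit_gt0.
  by case: ny; exists y.
exists gb => // g p' /andP[gbg gltb] /(star_unique bp) <-.
have Ng : N n g.
  by split => // y yb yn; exact: lt_le_trans (gbP y yb yn) gbg.
by rewrite !unbounded_indicesP (nP g Ng).
Qed.

(** * Realisation of an adapted set by a continuous map *)

Section Model.
Variable W : set (below alpha).
Hypothesis adW : adapted s W.

Let onW (P : Prop) x : ray := if `[< P >] then x else ray0 R.

(** The behaviour that [W] prescribes on the top edge of octant [g], read off the next octant; then
    the same data sorted by horizontal and diagonal edge. *)
Let topW g : Prop := exists2 h, next_octant g h & W h.
Let horW g : Prop := if s g is Up then W g else topW g.
Let diaW g : Prop := if s g is Up then topW g else W g.

Let topW_next g h : next_octant g h -> topW g <-> W h.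
Proof.
move=> gh; split=> [[h' gh' Wh']|Wh]; last by exists h.
by rewrite (next_fun gh gh').
Qed.

(** Upward closure of [W] excludes a map unbounded on the horizontal edge only, the one case that
    neither radius, height nor 0 would realise. *)
Let horW_diaW g : horW g -> diaW g.
Proof.
have [h gh] := next_exists g.
rewrite /horW /diaW; case E: (s g); [move=> Wg | move=> Wt].
  by apply/(topW_next gh); apply: adW.1 Wg _;
    apply: Relation_Operators.rt_step; left.
apply: adW.1 ((topW_next gh).1 Wt) _.
by apply: Relation_Operators.rt_step; right.
Qed.

Let model g (c : oct) : ray :=
  if `[< horW g >] then oct_radius c else onW (diaW g) (oct_height c).

Let model_edge g d x : model g (edge_pt d x) =
  onW (if d is Up then horW g else diaW g) x.
Proof.
rewrite /model edge_pt_radius /onW; case: d => /=.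
  by case: asboolP => // _; case: asboolP.
have [hg|nhg] := pselect (horW g).
  by rewrite asboolT // asboolT //; exact: horW_diaW.
by rewrite asboolF.
Qed.

Let model_bottom g x : model g (edge_pt (s g) x) = onW (W g) x.
Proof. by rewrite model_edge /horW /diaW; case: (s g). Qed.

Let model_top g x : model g (edge_pt (flip (s g)) x) = onW (topW g) x.
Proof. by rewrite model_edge /horW /diaW; case: (s g). Qed.

Let model_le_radius g (c : oct) : model g c <= oct_radius c.
Proof.
rewrite /model /onW; case: asboolP => // _; case: asboolP => _.
  exact: oct_coordsP.
exact: ray0P.
Qed.

Let continuous_model g : continuous (model g).
Proof.
rewrite /model /onW; case: asboolP => _; first exact: continuous_oct_radius.
by case: asboolP => _; [exact: continuous_oct_height | exact: cst_continuous].
Qed.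

Let model_glued p q : glued s p q ->
  model (tag p) (tagged p) = model (tag q) (tagged q).
Proof.
have origin (o : octants R alpha) : is_origin o ->
  model (tag o) (tagged o) = ray0 R.
  move=> /is_originE o0; apply/eqP; rewrite eq_le ray0P andbT.
  by rewrite -[X in _ <= X]o0 model_le_radius.
have em o o' : edge_match s o o' ->
  model (tag o) (tagged o) = model (tag o') (tagged o').
  case: o o' => [g c] [h d] [/= gh]; rewrite top_edge_flip.
  move=> /bottom_edgeE -> /bottom_edgeE ->; rewrite !edge_pt_radius => ->.
  rewrite model_top model_bottom /onW.
  by congr (if _ then _ else _); apply/asbool_equiv_eq/topW_next.
case=> [->//|[op oq]|/em//|/em//]; by rewrite !origin.
Qed.

Let fW (p : M) : ray := model (tag (repr p)) (tagged (repr p)).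

Let fW_surf_pt g (c : oct) : fW (surf_pt g c) = model g c.
Proof.
rewrite /fW; apply: (@model_glued _ (octant_pt g c)).
by apply/pi_glued; rewrite reprK.
Qed.

Let fW_edge g x : fW (edge_of g x) = onW (W g) x.
Proof. by rewrite fW_surf_pt model_bottom. Qed.

Let open_fW_octants (U : set ray) : open U ->
  open ((fun q : octants R alpha => fW (\pi_M q)%qT) @^-1` U).
Proof.
move=> oU.
have : continuous (fun q : octants R alpha => model (tag q) (tagged q)).
  exact: (@sigT_continuous _ (fun _ : below alpha =>
    oct) _ model continuous_model).
move=> /continuousP /(_ U oU).
have fE (q : octants R alpha) : fW (\pi_M q)%qT = model (tag q) (tagged q).
  by case: q => g c; exact: fW_surf_pt.
by congr open; apply/seteqP; split => q; rewrite /preimage /= fE.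
Qed.

(** The left end is kept above [ray0] so that it can also serve as a height bound satisfied on the
    horizontal edge. *)
Let nbhs_ray_itv x (U : set ray) : ray0 R < x -> nbhs x U ->
  exists a b, [/\ ray0 R < a, a < x, x < b & forall y, a < y < b -> U y].
Proof.
move=> x0; rewrite itv_nbhsE => -[i [oi xi] iU].
have [a0 /andP[a00 a0x]] := long_ray_gt0 x0.
have [b0 xb0] := long_ray_unbounded x.
case: i oi xi iU => [[[] a|[]] [[] b|[]]] //= _; rewrite in_itv /= ?andbT.
- move=> /andP[ax xb] iU; exists (Order.max a0 a), b.
  rewrite lt_max a00 gt_max a0x; split => // y.
  by rewrite gt_max => /andP[/andP[_ ay] yb]; apply: iU;
    rewrite /= in_itv /= ay.
- move=> ax iU; exists (Order.max a0 a), b0.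
  rewrite lt_max a00 gt_max a0x; split => // y.
  by rewrite gt_max => /andP[/andP[_ ay] yb]; apply: iU;
    rewrite /= in_itv /= ay.
- move=> xb iU; exists a0, b; split => // y /andP[_ yb].
  by apply: iU; rewrite /= in_itv.
- by move=> _ iU; exists a0, b0; split => // y _; apply: iU; rewrite /= in_itv.
Qed.

(** Just below [lam], the octants [i] and [i + 1] agree with [g] about [W], by the limit condition;
    both edges of [i] then behave alike, and the model there is the radius or 0, never the
    height. *)
Let fW_near_limit_edge (lam : omega1) g : limit_ord lam -> lam <= alpha ->
  star lam g -> exists2 mu : below alpha, val mu < lam &
    forall i, val mu <= val i < lam ->
      forall c, fW (surf_pt i c) = onW (W g) (oct_radius c).
Proof.
move=> lim lea st; have [gb gbl gbP] := adW.2 lam lim lea.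
exists (exist _ gb (lt_le_trans gbl lea)) => // i /andP[/= gi il] c.
have [h ih] := next_exists i.
have sih := next_infinite (limit_le_infinite lim lea) ih.
have Wi := gbP i g; have Wh := gbP h g.
have {}Wi : W i <-> W g by apply: Wi => //; rewrite gi il.
have {}Wh : W h <-> W g.
  by apply: Wh => //; rewrite (le_trans gi (ltW sih.1)) (limit_succ_lt lim sih
    il).
have Wt : topW i <-> W g by rewrite (topW_next ih).
rewrite fW_surf_pt /model /onW /horW /diaW.
have [Wg|nWg] := pselect (W g).
  rewrite [X in _ = if X then _ else _]asboolT // asboolT //.
  by case: (s i); [apply/Wi | apply/Wt].
rewrite [X in _ = if X then _ else _]asboolF // asboolF; last first.
  by case: (s i); [move/Wi | move/Wt].
by rewrite asboolF //; case: (s i); [move/Wt | move/Wi].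
Qed.

Let continuous_fW : continuous fW.
Proof.
apply/continuousP => U oU; have oO := open_fW_octants oU.
suff : surface_open (fW @^-1` U) by [].
split=> [_|inf p Up]; first exact: oO.
(* At the apex, [fW] is squeezed between 0 and the radius. *)
have [ap|nap] := pselect (is_apex p).
  have p0 := (apex_radius p).1 ap.
  have fW_le q : fW q <= surf_radius q.
    by have [g [c ->]] := surf_ptP q; rewrite fW_surf_pt surf_pt_radius.
  have fp0 : fW p = ray0 R.
    by apply/eqP; rewrite eq_le ray0P andbT -[X in _ <= X]p0 fW_le.
  have U0 : nbhs (ray0 R) U.
    by apply: open_nbhs_nbhs; split => //; rewrite -fp0.
  have [e e0 eU] := nbhs_right U0.
  exists [set q | surf_radius q < e]; first exact: apex_nbhd.
  by move=> q /= qe; apply: eU; [exact: ray0P | exact: le_lt_trans qe].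
have [[lam [g [lim lea st Dp]]]|nl] := pselect (on_limit_edge p); last first.
  exists (fW @^-1` U) => //; apply: glued_nbhd => // q qp.
  by apply: open_nbhs_nbhs; split => //; rewrite /= qp.
have r0 : ray0 R < surf_radius p.
  by rewrite lt_neqAle ray0P andbT; apply/eqP => r; apply/nap/apex_radius.
have fp : fW p = onW (W g) (surf_radius p).
  by move/DeltaP: (Dp) => pE; rewrite {1}pE fW_edge.
have [a [b [a0 ar rb abU]]] : exists a b, [/\ ray0 R < a, a < surf_radius p,
    surf_radius p < b & forall y, a < y < b -> U (onW (W g) y)].
  move: Up; rewrite /= fp /onW; case: asboolP => [Wg Up|_ U0].
    by apply: nbhs_ray_itv r0 _; apply: open_nbhs_nbhs.
  (* Here the map vanishes along the edge, so any interval around the radius will do. *)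
  have [a [b [? ? ? _]]] := nbhs_ray_itv r0 filterT.
  by exists a, b; split.
have [mu mul muP] := fW_near_limit_edge lim lea st.
(* The last condition keeps [V] off the top edge while retaining the bottom one: on the diagonal the
   height equals the radius, above [a], and on the horizontal edge it is 0. *)
pose V : set oct := [set c | a < oct_radius c] `&` [set c | oct_radius c < b]
  `&`
  (model g @^-1` U) `&`
  (if s g is Up then [set c | oct_height c < a] else [set c | ray0 R <
    oct_height c]).
have olt (f : oct -> ray) y : continuous f -> open [set c | f c < y].
  move=> cf; rewrite -closedC;
    have -> : ~` [set c | f c < y] = [set c | y <= f c].
    by apply/seteqP; split => c /=; rewrite leNgt => /negP.
  exact: closed_ge_fun.
have ogt (f : oct -> ray) y : continuous f -> open [set c | y < f c].
  move=> cf; rewrite -closedC;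
    have -> : ~` [set c | y < f c] = [set c | f c <= y].
    by apply/seteqP; split => c /=; rewrite leNgt => /negP.
  exact: closed_le_fun.
have oV : open V.
  apply: openI; first apply: openI; first apply: openI.
  - exact: ogt (@continuous_oct_radius R).
  - exact: olt (@continuous_oct_radius R).
  - by move: (@continuous_model g) => /continuousP; exact.
  - case: (s g); first exact: olt (@continuous_oct_height R).
    exact: ogt (@continuous_oct_height R).
have tV : V `&` top_edge (s g) = set0.
  apply/seteqP; split => // c [[[[/= ac _] _]]]; rewrite /top_edge /oct_height.
  case: (s g) => /= + E; last by rewrite E ltxx.
  by rewrite E ltNge (ltW ac).
have bV : V `&` bottom_edge (s g) =
    [set c | bottom_edge (s g) c /\ a < oct_radius c < b].
  apply/seteqP; split => [c [[[[/= ac cb] _] _] bc]|c [bc /andP[ac cb]]].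
    by rewrite ac cb.
  split => //; split.
    split; first by split.
    by rewrite /= (bottom_edgeE bc) model_bottom; apply: abU; rewrite ac cb.
  move: bc; rewrite /bottom_edge /oct_height; case: (s g) => /= ->;
    first exact: a0.
  exact: lt_trans a0 ac.
exists (surf_pt g @` V `|`
    ((\bigcup_(i in [set i : below alpha | val mu <= val i < lam])
        octant_image i `\` Delta mu) `&` [set q | a < surf_radius q < b])).
  exact: limit_nbhd.
move=> q [[c [[_ /= Uc] _] <-]|[[[i /= il [c _ <-]] _] /= cab]].
  by rewrite /= fW_surf_pt.
by rewrite /= (muP i il c) -(surf_pt_radius i); exact: abU.
Qed.

Lemma adapted_realised : exists2 f : M -> ray, continuous f &
  unbounded_indices f = W.
Proof.
exists fW => //; apply/seteqP; suff E g : unbounded_indices fW g <-> W g.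
  by split=> g; apply E.
rewrite unbounded_indicesP; split=> [nb|Wg [b bP]].
  apply: contrapT => nWg; apply: nb; exists (ray0 R) => x /=.
  by rewrite fW_edge /onW asboolF.
have [c bc] := long_ray_unbounded b.
by have := bP c; rewrite /= fW_edge /onW asboolT // leNgt bc.
Qed.

End Model.

End Indices.

End SurfaceMaps.

Theorem theorem1 (R : realType) (alpha : omega1) (s : below alpha -> direction)
    (halpha : (alpha <> omega1_0 /\ finite_ord alpha) \/ limit_ord alpha) :
  exists Phi : homotopy_classes R (surface R s) (long_ray R) ->
               set (below alpha),
    (forall f : continuousType (surface R s) (long_ray R),
       Phi (homotopy_class R f) = unbounded_indices f) /\
    set_bij [set: homotopy_classes R (surface R s) (long_ray R)]
      [set W | adapted s W] Phi.
Proof.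
pose Phi (q : homotopy_classes R (surface R s) (long_ray R)) :=
  unbounded_indices (repr q : continuousType (surface R s) (long_ray R)).
have PhiE f : Phi (homotopy_class R f) = unbounded_indices f.
  apply: indices_of_homotopic; apply/asboolP.
  suff : homotopicb_equiv R (surface R s) (long_ray R) (repr (homotopy_class R
    f)) f.
    by [].
  by apply/eqmodP; rewrite reprK.
have classE (q : homotopy_classes R (surface R s) (long_ray R)) : exists f,
  q = homotopy_class R f.
  by exists (repr q); rewrite /homotopy_class reprK.
exists Phi; split => //; split.
- move=> q _; have [f ->] := classE q; rewrite /= PhiE.
  by apply: indices_adapted => //; exact: cts_fun.
- move=> q q' _ _; have [f ->] := classE q; have [f' ->] := classE q'.
  rewrite !PhiE => E; apply/eqmodP; apply/asboolP.
  exact: homotopic_of_indices.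
- move=> W /= /(adapted_realised R halpha)[h ch <-].
  by exists (homotopy_class R (mkcts ch)); rewrite ?PhiE.
Qed.
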